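(* If $\mathbf{k}$ is an integral domain and $\Gamma$ is a finite digraph whose cycles are pairwise disjoint, then $GKdim_{\mathbf{k}}\,L_{\mathbf{k}}(\Gamma)=ht(\Gamma)$.
   Context: A digraph $\Gamma=(V,E,s,t)$ has vertex set $V$, arrow set $E$, and source and target maps $s,t:E\to V$ (written $se$, $te$). It is finite if $V$ and $E$ are finite. A sink is a vertex $v$ with $s^{-1}(v)=\emptyset$. A path of length $n>0$ is a sequence $p=e_1\cdots e_n$ of arrows with $te_i=se_{i+1}$; a path of length 0 is a vertex. A cycle is a path $C=e_1\cdots e_n$ with $n>0$, $sC=tC$ and $se_i\neq se_j$ for $i\neq j$; cycles differing by cyclic rotation are identified. An exit of $C$ is an arrow $e$ with $se=se_i$ and $e\neq e_i$ for some $i$. Cycles are pairwise disjoint if distinct cycles have no common vertex. For vertices, $u\leadsto v$ means there is a path from $u$ to $v$. When cycles are pairwise disjoint this induces a partial order $\leadsto$ on the set of sinks and cycles of $\Gamma$ ($x\leadsto y$ if there is a path from a vertex of $x$ to a vertex of $y$). Height: the height of a sink is 0; the height of a cycle with no exit is 1; the height of a cycle $C$ with an exit is defined recursively by $ht(C)=2+\max\{ht(x)\mid C\leadsto x,\ x\neq C\}$ (with $x$ ranging over sinks and cycles). The height $ht(\Gamma)$ is the maximum of the heights of the cycles of $\Gamma$, or 0 if $\Gamma$ has no cycles. The Leavitt path algebra $L_{\mathbf{k}}(\Gamma)$ is the $\mathbf{k}$-algebra generated by $V\sqcup E\sqcup E^*$, where $E^*=\{e^*: e\in E\}$ with $s(e^*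 )=te$, $t(e^* )=se$, subject to: (V) $vw=\delta_{v,w}v$ for $v,w\in V$; (E) $(se)e=e=e(te)$ for $e\in E\sqcup E^*$; (CK1) $e^*f=\delta_{e,f}\,te$ for $e,f\in E$; (CK2) $v=\sum_{se=v}ee^*$ for all $v\in V$ with $0<|s^{-1}(v)|<\infty$. For $\Gamma$ finite it has $1=\sum_{v\in V}v$. For a finitely generated algebra $A$ with 1 over a commutative domain $\mathbf{k}$, $GKdim_{\mathbf{k}}(A)=\limsup_{n\to\infty}\frac{\log(rank^{\mathbf{k}}(W^n))}{\log n}$, where $W$ is a finitely generated $\mathbf{k}$-submodule of $A$ generating $A$ as an algebra with $1\in W$, $W^n$ is the $\mathbf{k}$-span of $n$-fold products of elements of $W$, and $rank^{\mathbf{k}}(N)$ is the dimension of $\mathbb{F}\otimes_{\mathbf{k}}N$ over the field of fractions $\mathbb{F}$ of $\mathbf{k}$. *)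

(* Defs.v *)
From HB Require Import structures.
From mathcomp Require Import all_boot all_order all_algebra.
From mathcomp Require Import boolp classical_sets reals ereal sequences exp.

Set Implicit Arguments.
Unset Strict Implicit.
Unset Printing Implicit Defensive.

Import Order.TTheory GRing.Theory Num.Theory.
Local Open Scope ring_scope.
Local Open Scope quotient_scope.

Record digraph := Digraph {
  vertex : finType;
  arrow : finType;
  src : arrow -> vertex;
  tgt : arrow -> vertex }.

Section Height.
Variable G : digraph.
Local Notation V := (vertex G).
Local Notation E := (arrow G).

Definition sink (v : V) : bool := [forall e : E, src e != v].

Definition adj : rel V := [rel u v | [exists e : E, (src e == u) && (tgt e == v)]].

(* path.cycle includes the closing condition tgt e_n = src e_1, but accepts
   the empty sequence. *)
Definition is_cycle (c : seq E) : bool :=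
  [&& c != [::], cycle (fun e f : E => tgt e == src f) c
    & uniq [seq src e | e <- c]].

Definition rotation (c d : seq E) : bool := [exists i : 'I_(size c), d == rot i c].

Definition disjoint_cycles : Prop :=
  forall c d : seq E, is_cycle c -> is_cycle d -> ~~ rotation c d ->
  forall v : V, ~ (v \in [seq src e | e <- c] /\ v \in [seq src e | e <- d]).

Definition has_exit (c : seq E) : bool :=
  [exists e : E, [exists f : E, [&& f \in c, src e == src f & e != f]]].

(* The sources of the arrows of a cycle are distinct, so its length is at most
   #|V|.  A [cyc] is a cycle with a starting point: cycles in the usual sense
   are [cyc]s up to [rotation]. *)
Definition cyc := {c : #|V|.-bseq E | is_cycle c}.

Definition node : Type := {v : V | sink v} + cyc.
HB.instance Definition _ := Finite.on node.

Definition node_vertices (x : node) : seq V :=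
  match x with
  | inl v => [:: val v]
  | inr c => [seq src e | e <- val c]
  end.

Definition same_node (x y : node) : bool :=
  match x, y with
  | inl u, inl v => u == v
  | inr c, inr d => rotation (val c) (val d)
  | _, _ => false
  end.

Definition leads (x y : node) : bool :=
  has (fun u => has (connect adj u) (node_vertices y)) (node_vertices x).

Fixpoint height_rec (n : nat) (x : node) : nat :=
  if n isn't m.+1 then 0 else
  match x with
  | inl _ => 0
  | inr c => if has_exit (val c)
             then 2 + \max_(y : node | leads x y && ~~ same_node x y)
                        height_rec m y
             else 1
  end%N.

(* The fuel #|node| suffices when the cycles are disjoint, see [height_exit]. *)
Definition height (x : node) : nat := height_rec #|{: node}| x.

Definition graph_height : nat := (\max_(c : cyc) height (inr c))%N.

End Height.

Section HeightTheory.
Variable G : digraph.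
Local Notation V := (vertex G).
Local Notation E := (arrow G).
Hypothesis dis : disjoint_cycles G.
Implicit Types (c d : seq E) (u v w : V).

Lemma size_cycle c : is_cycle c -> (size c <= #|V|)%N.
Proof.
case/and3P=> _ _ Uc; rewrite -(size_map (@src G)) -(card_uniqP Uc).
exact: max_card.
Qed.

Lemma same_nodexx (x : node G) : same_node x x.
Proof.
case: x => [v|c] /=; first exact: eqxx.
have /and3P[c0 _ _] := valP c.
apply/existsP; have lt0 : (0 < size (val c))%N by rewrite lt0n size_eq0.
by exists (Ordinal lt0); rewrite /= rot0.
Qed.

Lemma rotation_mem c d : rotation c d -> c =i d.
Proof. by move=> /existsP[i /eqP->] e; rewrite mem_rot. Qed.

Lemma rotationP c d v : is_cycle c -> is_cycle d ->
  v \in [seq src e | e <- c] -> v \in [seq src e | e <- d] -> rotation c d.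
Proof.
move=> cc cd vc vd; case: (boolP (rotation c d)) => // N.
by case: (dis cc cd N (conj vc vd)).
Qed.

Lemma path_arrows u p : path (@adj G) u p ->
  exists q : seq E, [/\ [seq src e | e <- q] = belast u p,
    [seq tgt e | e <- q] = p & sorted (fun e f : E => tgt e == src f) q].
Proof.
elim: p u => [|v p IH] u /=; first by exists [::].
case/andP=> /existsP[e /andP[/eqP se /eqP te]] /IH[q [sq tq pq]].
exists (e :: q); rewrite /= se te sq tq; split=> //.
by case: q p sq pq {tq IH} => [|f q] [|w p] //= [sf _] ->; rewrite te sf eqxx.
Qed.

Lemma return_arrow c (e : E) : is_cycle c ->
  src e \in [seq src f | f <- c] -> connect (@adj G) (tgt e) (src e) -> e \in c.
Proof.
move=> cc ec /connectP[p0 p0P last0].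
case/shortenP: p0P last0 => p pP Up _ lastp.
have [q [sq tq qP]] := path_arrows pP.
have cq : is_cycle (e :: q).
  apply/and3P; split=> //=.
    have: (last (tgt e) [seq tgt f | f <- q]) == src e by rewrite tq -lastp.
    rewrite last_map rcons_path => ->; rewrite andbT.
    case: q sq qP {tq} => [|f q] //=.
    by case: p {pP Up lastp} => [|w p] //= [-> _] ->; rewrite eqxx.
  by rewrite sq; have := Up; rewrite lastI rcons_uniq -lastp.
by rewrite (rotation_mem (rotationP cc cq ec _)) ?mem_head.
Qed.

Lemma tgt_in_cycle c (e : E) : is_cycle c -> e \in c ->
  tgt e \in [seq src f | f <- c].
Proof.
case/and3P=> _ cc _ ec; have := next_cycle cc ec => /eqP ->.
by apply: map_f; rewrite mem_next.
Qed.

Lemma cycle_connect c u w : is_cycle c ->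
  u \in [seq src f | f <- c] -> w \in [seq src f | f <- c] ->
  connect (@adj G) u w.
Proof.
case/and3P=> _ cc _ /mapP[e ec ->] /mapP[f fc ->].
have step x y : tgt x == src y -> connect (@adj G) (src x) (src y).
  move=> /eqP xy; apply: connect1; apply/existsP; exists x.
  by rewrite eqxx xy eqxx.
have tr : connect (fun e f : E => tgt e == src f) e f.
  by apply: (connect_cycle cc).
case/connectP: tr => p; elim: p e {ec} => [|g p IH] e /=; first by move=> _ ->.
by case/andP=> eg /IH{}IH /IH; apply: connect_trans; apply: step.
Qed.

Lemma return_vertex c u w u' : is_cycle c ->
  u \in [seq src f | f <- c] -> u' \in [seq src f | f <- c] ->
  connect (@adj G) u w -> connect (@adj G) w u' -> w \in [seq src f | f <- c].
Proof.
move=> cc uc u'c /connectP[p pP ->] {w}.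
elim: p u uc pP => [|v p IH] u uc //= /andP[/existsP[e /andP[/eqP se /eqP te]] pP] wu'.
apply: (IH v) => //; rewrite -te; apply: tgt_in_cycle => //.
apply: return_arrow; rewrite // ?se //.
apply: connect_trans (cycle_connect cc u'c uc); apply: connect_trans wu'.
by apply/connectP; exists p; rewrite // te.
Qed.

Lemma sink_connect v w : sink v -> connect (@adj G) v w -> w = v.
Proof.
move=> /forallP sv /connectP[[|u p] //=] /andP[/existsP[e /andP[se _]] _].
by have := sv e; rewrite se.
Qed.

Lemma cycle_not_sink c v : v \in [seq src f | f <- c] -> ~~ sink v.
Proof.
by case/mapP=> e _ ->; apply/forallPn; exists e; rewrite negbK.
Qed.

Lemma leadsP (x y : node G) : reflect
  (exists u w, [/\ u \in node_vertices x, w \in node_vertices y &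
     connect (@adj G) u w]) (leads x y).
Proof.
apply: (iffP hasP) => [[u ux /hasP[w wy uw]]|[u [w [ux wy uw]]]].
  by exists u, w.
by exists u => //; apply/hasP; exists w.
Qed.

Lemma node_connect (x : node G) u w :
  u \in node_vertices x -> w \in node_vertices x -> connect (@adj G) u w.
Proof.
case: x => [v|c] /=; last exact: cycle_connect (valP c).
by rewrite !inE => /eqP-> /eqP->.
Qed.

Lemma leads_trans (y x z : node G) : leads x y -> leads y z -> leads x z.
Proof.
move=> /leadsP[u [w [ux wy uw]]] /leadsP[u' [w' [u'y w'z u'w']]].
apply/leadsP; exists u, w'; split=> //.
by apply: (connect_trans uw); apply: connect_trans u'w'; apply: node_connect u'y.
Qed.

Lemma leads_anti (x y : node G) : leads x y -> leads y x -> same_node x y.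
Proof.
move=> /leadsP[u [w [ux wy uw]]] /leadsP[w' [u' [w'y u'x w'u']]].
have wu' := connect_trans (node_connect wy w'y) w'u'.
case: x y ux wy u'x {w'y} => [v|c] [v'|d] /=; rewrite ?inE.
- move=> /eqP uv /eqP wv _; apply/eqP/val_inj => /=.
  rewrite -uv -wv; symmetry; apply: sink_connect uw.
  by rewrite uv; apply: (valP v).
- move=> /eqP uv wd _; have := cycle_not_sink wd.
  by rewrite (sink_connect _ uw) uv ?(valP v).
- move=> uc /eqP wv u'c; have := cycle_not_sink u'c.
  by rewrite (sink_connect _ wu') wv ?(valP v').
move=> uc wd u'c; apply: rotationP (valP c) (valP d) _ wd.
exact: return_vertex (valP c) uc u'c uw wu'.
Qed.

Let below (x : node G) := [pred y | leads x y && ~~ same_node x y].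

Lemma below_card (x y : node G) : y \in below x -> (#|below y| < #|below x|)%N.
Proof.
move=> yx; apply: proper_card; apply/properP; split; last first.
  by exists y => //; rewrite !inE same_nodexx andbF.
case/andP: yx => xy nxy; apply/fintype.subsetP=> z /andP[yz _].
rewrite inE (leads_trans xy yz) /=; apply: contra nxy => xz.
apply: leads_anti => //; apply: (leads_trans yz).
case: x z xz {xy yz} => [u|c] [v|d] //= => [/eqP->|cd].
  by apply/leadsP; exists (val v), (val v); rewrite /= !inE eqxx connect0.
have [e ec] : exists e, e \in (val c : seq E).
  have /and3P[c0 _ _] := valP c.
  by case: (val c : seq E) c0 => // e s _; exists e; rewrite mem_head.
apply/leadsP; exists (src e), (src e); split=> //=; apply: map_f => //.
by rewrite -(rotation_mem cd).
Qed.

Lemma height_rec_stable n m (x : node G) : (#|below x| < n)%N ->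
  (#|below x| < m)%N -> height_rec n x = height_rec m x.
Proof.
elim: n m x => [|n IH] [|m] // [//|c] xn xm /=; case: ifP => // _.
congr (_ + _)%N; apply: eq_bigr => y xy; have yx := below_card xy.
by apply: IH; [apply: (leq_trans yx xn)|apply: (leq_trans yx xm)].
Qed.

Lemma height_sink (v : {v : V | sink v}) : height (inl v : node G) = 0%N.
Proof. by rewrite /height; case: #|_|. Qed.

Let below_fuel (x : node G) : (#|below x| < #|{: node G}|)%N.
Proof.
apply: proper_card; apply/properP; split; first exact/fintype.subsetP.
by exists x => //; rewrite !inE same_nodexx andbF.
Qed.

Lemma height_no_exit (c : cyc G) : ~~ has_exit (val c) ->
  height (inr c : node G) = 1%N.
Proof.
rewrite /height; have := below_fuel (inr c).
by case: #|{: node G}| => // n _ /= /negPf->.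
Qed.

Lemma height_exit (c : cyc G) : has_exit (val c) ->
  height (inr c : node G) =
  (2 + \max_(y : node G | leads (inr c) y && ~~ same_node (inr c) y) height y)%N.
Proof.
move=> ec; rewrite {1}/height.
rewrite (@height_rec_stable _ #|{: node G}|.+1) ?(leqW (below_fuel _)) //=.
by rewrite ec.
Qed.

End HeightTheory.

Section Leavitt.
Variables (k : comNzRingType) (G : digraph).
Local Notation V := (vertex G).
Local Notation E := (arrow G).

(* L_k(G) is built from its presentation as a possibly non-unital k-algebra:
   formal expressions in the generators, modulo the least congruence
   containing the algebra laws and the relations (V), (E), (CK1), (CK2). *)
Inductive lterm : Type :=
  | LVertex of V
  | LArrow of E
  | LStar of E
  | LZero
  | LAdd of lterm & lterm
  | LOpp of lterm
  | LScale of k & lterm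
  | LMul of lterm & lterm.

HB.instance Definition _ := gen_eqMixin lterm.
HB.instance Definition _ := gen_choiceMixin lterm.

Inductive lcong : lterm -> lterm -> Prop :=
  | lcong_refl x : lcong x x
  | lcong_sym x y : lcong x y -> lcong y x
  | lcong_trans x y z : lcong x y -> lcong y z -> lcong x z
  | lcong_add x x' y y' : lcong x x' -> lcong y y' -> lcong (LAdd x y) (LAdd x' y')
  | lcong_opp x x' : lcong x x' -> lcong (LOpp x) (LOpp x')
  | lcong_scale a x x' : lcong x x' -> lcong (LScale a x) (LScale a x')
  | lcong_mul x x' y y' : lcong x x' -> lcong y y' -> lcong (LMul x y) (LMul x' y')
  | lcong_addA x y z : lcong (LAdd x (LAdd y z)) (LAdd (LAdd x y) z)
  | lcong_addC x y : lcong (LAdd x y) (LAdd y x)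
  | lcong_add0 x : lcong (LAdd LZero x) x
  | lcong_addN x : lcong (LAdd (LOpp x) x) LZero
  | lcong_scaleA a b x : lcong (LScale a (LScale b x)) (LScale (a * b) x)
  | lcong_scale1 x : lcong (LScale 1 x) x
  | lcong_scaleDr a x y :
      lcong (LScale a (LAdd x y)) (LAdd (LScale a x) (LScale a y))
  | lcong_scaleDl a b x :
      lcong (LScale (a + b) x) (LAdd (LScale a x) (LScale b x))
  | lcong_mulA x y z : lcong (LMul x (LMul y z)) (LMul (LMul x y) z)
  | lcong_mulDl x y z : lcong (LMul (LAdd x y) z) (LAdd (LMul x z) (LMul y z))
  | lcong_mulDr x y z : lcong (LMul x (LAdd y z)) (LAdd (LMul x y) (LMul x z))
  | lcong_scaleAl a x y : lcong (LScale a (LMul x y)) (LMul (LScale a x) y)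
  | lcong_scaleAr a x y : lcong (LScale a (LMul x y)) (LMul x (LScale a y))
  | lcong_V v w : lcong (LMul (LVertex v) (LVertex w))
                    (if v == w then LVertex v else LZero)
  | lcong_E_src e : lcong (LMul (LVertex (src e)) (LArrow e)) (LArrow e)
  | lcong_E_tgt e : lcong (LMul (LArrow e) (LVertex (tgt e))) (LArrow e)
  | lcong_E_star_src e : lcong (LMul (LVertex (tgt e)) (LStar e)) (LStar e)
  | lcong_E_star_tgt e : lcong (LMul (LStar e) (LVertex (src e))) (LStar e)
  | lcong_CK1 e f : lcong (LMul (LStar e) (LArrow f))
                      (if e == f then LVertex (tgt e) else LZero)
  | lcong_CK2 v : ~~ sink v ->
      lcong (LVertex v)
          (\big[LAdd/LZero]_(e : E | src e == v) LMul (LArrow e) (LStar e)).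

Definition lcongb (x y : lterm) : bool := `[< lcong x y >].

Lemma lcongb_refl : reflexive lcongb.
Proof. by move=> x; apply/asboolP/lcong_refl. Qed.
Lemma lcongb_sym : symmetric lcongb.
Proof. by move=> x y; apply/asboolP/asboolP; apply: lcong_sym. Qed.
Lemma lcongb_trans : transitive lcongb.
Proof.
by move=> y x z /asboolP xy /asboolP yz; apply/asboolP; apply: lcong_trans yz.
Qed.

Canonical lcong_equiv := EquivRel lcongb lcongb_refl lcongb_sym lcongb_trans.

Definition leavitt : Type := {eq_quot lcong_equiv}.
HB.instance Definition _ := Choice.on leavitt.
HB.instance Definition _ := Quotient.on leavitt.
HB.instance Definition _ := EqQuotient.on leavitt.

Local Notation cl := (\pi_leavitt).

Lemma leavittP (x y : lterm) : lcong x y <-> cl x = cl y.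
Proof.
split=> [xy|]; first by apply/eqmodP/asboolP.
by move=> /eqmodP /asboolP.
Qed.

Definition lv_add := lift_op2 leavitt LAdd.
Definition lv_opp := lift_op1 leavitt LOpp.
Definition lv_scale (a : k) := lift_op1 leavitt (LScale a).
Definition lv_mul := lift_op2 leavitt LMul.
Definition lv_one : leavitt := cl (\big[LAdd/LZero]_(v : V) LVertex v).

Lemma lcong_repr x : lcong (repr (cl x)) x.
Proof. by apply/leavittP; rewrite reprK. Qed.

Lemma cl_add x y : lv_add (cl x) (cl y) = cl (LAdd x y).
Proof. by unlock lv_add; apply/leavittP; apply: lcong_add; apply: lcong_repr. Qed.
Lemma cl_opp x : lv_opp (cl x) = cl (LOpp x).
Proof. by unlock lv_opp; apply/leavittP; apply: lcong_opp; apply: lcong_repr. Qed.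
Lemma cl_scale a x : lv_scale a (cl x) = cl (LScale a x).
Proof. by unlock lv_scale; apply/leavittP; apply: lcong_scale; apply: lcong_repr. Qed.
Lemma cl_mul x y : lv_mul (cl x) (cl y) = cl (LMul x y).
Proof. by unlock lv_mul; apply/leavittP; apply: lcong_mul; apply: lcong_repr. Qed.

Let clE := (cl_add, cl_opp, cl_scale, cl_mul).

Lemma lv_addA : associative lv_add.
Proof.
elim/quotW=> x; elim/quotW=> y; elim/quotW=> z; rewrite !clE.
by apply/leavittP; apply: lcong_addA.
Qed.
Lemma lv_addC : commutative lv_add.
Proof.
by elim/quotW=> x; elim/quotW=> y; rewrite !clE; apply/leavittP; apply: lcong_addC.
Qed.
Lemma lv_add0 : left_id (cl LZero) lv_add.
Proof. by elim/quotW=> x; rewrite !clE; apply/leavittP; apply: lcong_add0. Qed.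
Lemma lv_addN : left_inverse (cl LZero) lv_opp lv_add.
Proof. by elim/quotW=> x; rewrite !clE; apply/leavittP; apply: lcong_addN. Qed.

HB.instance Definition _ :=
  GRing.isZmodule.Build leavitt lv_addA lv_addC lv_add0 lv_addN.

Lemma lv_scaleA a b x : lv_scale a (lv_scale b x) = lv_scale (a * b) x.
Proof. by elim/quotW: x => x; rewrite !clE; apply/leavittP; apply: lcong_scaleA. Qed.
Lemma lv_scale1 : left_id 1 lv_scale.
Proof. by elim/quotW=> x; rewrite !clE; apply/leavittP; apply: lcong_scale1. Qed.
Lemma lv_scaleDr : right_distributive lv_scale +%R.
Proof.
move=> a; elim/quotW=> x; elim/quotW=> y.
by rewrite /GRing.add /= !clE; apply/leavittP; apply: lcong_scaleDr.
Qed.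
Lemma lv_scaleDl x : {morph lv_scale^~ x : a b / a + b}.
Proof.
elim/quotW: x => x a b.
by rewrite [in RHS]/GRing.add /= !clE; apply/leavittP; apply: lcong_scaleDl.
Qed.

HB.instance Definition _ := GRing.Zmodule_isLmodule.Build k leavitt
  lv_scaleA lv_scale1 lv_scaleDr lv_scaleDl.

Lemma lv_mulA : associative lv_mul.
Proof.
elim/quotW=> x; elim/quotW=> y; elim/quotW=> z; rewrite !clE.
by apply/leavittP; apply: lcong_mulA.
Qed.
Lemma lv_mulDl : left_distributive lv_mul +%R.
Proof.
elim/quotW=> x; elim/quotW=> y; elim/quotW=> z.
by rewrite /GRing.add /= !clE; apply/leavittP; apply: lcong_mulDl.
Qed.
Lemma lv_mulDr : right_distributive lv_mul +%R.
Proof.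
elim/quotW=> x; elim/quotW=> y; elim/quotW=> z.
by rewrite /GRing.add /= !clE; apply/leavittP; apply: lcong_mulDr.
Qed.
Lemma lv_scaleAl a x y : lv_scale a (lv_mul x y) = lv_mul (lv_scale a x) y.
Proof.
elim/quotW: x => x; elim/quotW: y => y; rewrite !clE.
by apply/leavittP; apply: lcong_scaleAl.
Qed.
Lemma lv_scaleAr a x y : lv_scale a (lv_mul x y) = lv_mul x (lv_scale a y).
Proof.
elim/quotW: x => x; elim/quotW: y => y; rewrite !clE.
by apply/leavittP; apply: lcong_scaleAr.
Qed.

Lemma cl_sum (I : finType) (P : pred I) (F : I -> lterm) :
  cl (\big[LAdd/LZero]_(i | P i) F i) = \sum_(i | P i) cl (F i).
Proof. by apply: big_morph => // x y; rewrite -cl_add. Qed.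

Let lv_mul0l x : lv_mul 0 x = 0.
Proof. by apply: (addrI (lv_mul 0 x)); rewrite -lv_mulDl !addr0. Qed.
Let lv_mul0r x : lv_mul x 0 = 0.
Proof. by apply: (addrI (lv_mul x 0)); rewrite -lv_mulDr !addr0. Qed.
Let lv_mul_suml (I : finType) (F : I -> leavitt) x :
  lv_mul (\sum_i F i) x = \sum_i lv_mul (F i) x.
Proof.
by apply: (big_morph (lv_mul^~ x)) => // y z; apply: lv_mulDl.
Qed.
Let lv_mul_sumr (I : finType) (F : I -> leavitt) x :
  lv_mul x (\sum_i F i) = \sum_i lv_mul x (F i).
Proof.
by apply: (big_morph (lv_mul x)) => // y z; apply: lv_mulDr.
Qed.
Let lv_scaleE a x : lv_scale a x = a *: x. Proof. by []. Qed.

Let mulVV v w : lv_mul (cl (LVertex v)) (cl (LVertex w)) =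
  if v == w then cl (LVertex v) else 0.
Proof.
by rewrite clE; move/leavittP: (lcong_V v w) => ->; case: ifP.
Qed.

Let lv_oneE : lv_one = \sum_v cl (LVertex v). Proof. exact: cl_sum. Qed.

Let one_mulV v : lv_mul lv_one (cl (LVertex v)) = cl (LVertex v).
Proof.
rewrite lv_oneE lv_mul_suml (bigD1 v) //= mulVV eqxx big1 ?addr0 // => w wv.
by rewrite mulVV (negPf wv).
Qed.
Let mulV_one v : lv_mul (cl (LVertex v)) lv_one = cl (LVertex v).
Proof.
rewrite lv_oneE lv_mul_sumr (bigD1 v) //= mulVV eqxx big1 ?addr0 // => w wv.
by rewrite mulVV eq_sym (negPf wv).
Qed.

Lemma lv_mul1l : left_id lv_one lv_mul.
Proof.
elim/quotW; elim=> [v|e|e||x IHx y IHy|x IHx|a x IHx|x IHx y IHy].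
- exact: one_mulV.
- by have /leavittP := lcong_E_src e; rewrite -cl_mul => <-; rewrite lv_mulA one_mulV.
- by have /leavittP := lcong_E_star_src e; rewrite -cl_mul => <-; rewrite lv_mulA one_mulV.
- exact: lv_mul0r.
- by rewrite -cl_add lv_mulDr IHx IHy.
- have -> : cl (LOpp x) = - cl x by rewrite -cl_opp.
  by apply: (addIr (lv_mul lv_one (cl x))); rewrite -lv_mulDr IHx addNr lv_mul0r.
- by rewrite -cl_scale -lv_scaleAr IHx.
- by rewrite -cl_mul lv_mulA IHx.
Qed.

Lemma lv_mul1r : right_id lv_one lv_mul.
Proof.
elim/quotW; elim=> [v|e|e||x IHx y IHy|x IHx|a x IHx|x IHx y IHy].
- exact: mulV_one.
- by have /leavittP := lcong_E_tgt e; rewrite -cl_mul => <-; rewrite -lv_mulA mulV_one.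
- by have /leavittP := lcong_E_star_tgt e; rewrite -cl_mul => <-; rewrite -lv_mulA mulV_one.
- exact: lv_mul0l.
- by rewrite -cl_add lv_mulDl IHx IHy.
- have -> : cl (LOpp x) = - cl x by rewrite -cl_opp.
  by apply: (addIr (lv_mul (cl x) lv_one)); rewrite -lv_mulDl IHx addNr lv_mul0l.
- by rewrite -cl_scale -lv_scaleAl IHx.
- by rewrite -cl_mul -lv_mulA IHy.
Qed.

HB.instance Definition _ := GRing.Zmodule_isPzRing.Build leavitt
  lv_mulA lv_mul1l lv_mul1r lv_mulDl lv_mulDr.

End Leavitt.

(* GRing.Algebra excludes the zero ring, which is L_k of the empty digraph.
   HB does not allow a new structure below GRing.LSemiAlgebra that extends both
   GRing.PzRing and GRing.Lmodule, so the module structure of a [pzAlgType] is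
   derived from the fields of the mixin. *)
HB.mixin Record isPzAlgebra (k : pzRingType) A of GRing.PzRing A := {
  pz_scale : k -> A -> A;
  pz_scalerA : forall a b x, pz_scale a (pz_scale b x) = pz_scale (a * b) x;
  pz_scale1r : left_id 1 pz_scale;
  pz_scalerDr : right_distributive pz_scale +%R;
  pz_scalerDl : forall x, {morph pz_scale^~ x : a b / a + b};
  pz_scalerAl_subproof : forall a (x y : A), pz_scale a (x * y) = pz_scale a x * y;
  pz_scalerAr_subproof : forall a (x y : A), pz_scale a (x * y) = x * pz_scale a y }.

#[short(type="pzAlgType")]
HB.structure Definition PzAlgebra (k : pzRingType) :=
  {A of isPzAlgebra k A & GRing.PzRing A}.

HB.instance Definition _ (k : pzRingType) (A : pzAlgType k) :=
  GRing.Zmodule_isLmodule.Build k (PzAlgebra.sort A)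
    (@pz_scalerA k A) (@pz_scale1r k A) (@pz_scalerDr k A) (@pz_scalerDl k A).

Lemma pz_scalerAl (k : pzRingType) (A : pzAlgType k) (a : k) (x y : A) :
  a *: (x * y) = (a *: x) * y.
Proof. exact: pz_scalerAl_subproof. Qed.

Lemma pz_scalerAr (k : pzRingType) (A : pzAlgType k) (a : k) (x y : A) :
  a *: (x * y) = x * (a *: y).
Proof. exact: pz_scalerAr_subproof. Qed.

HB.instance Definition _ (k : comNzRingType) (G : digraph) :=
  isPzAlgebra.Build k (leavitt k G)
    (@lv_scaleA k G) (@lv_scale1 k G) (@lv_scaleDr k G) (@lv_scaleDl k G)
    (@lv_scaleAl k G) (@lv_scaleAr k G).

Section FractionTensor.
Variables (k : idomainType) (N : lmodType k).
Local Notation F := {fraction k}.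

(* F (x)_k N, presented as an F-vector space by the pure tensors f (x) x and
   the relations making (x) biadditive, k-balanced and F-linear on the left. *)
Inductive tterm : Type :=
  | TPure of F & N
  | TZero
  | TAdd of tterm & tterm
  | TOpp of tterm
  | TScale of F & tterm.

HB.instance Definition _ := gen_eqMixin tterm.
HB.instance Definition _ := gen_choiceMixin tterm.

Inductive tcong : tterm -> tterm -> Prop :=
  | tcong_refl x : tcong x x
  | tcong_sym x y : tcong x y -> tcong y x
  | tcong_trans x y z : tcong x y -> tcong y z -> tcong x z
  | tcong_add x x' y y' : tcong x x' -> tcong y y' -> tcong (TAdd x y) (TAdd x' y')
  | tcong_opp x x' : tcong x x' -> tcong (TOpp x) (TOpp x')
  | tcong_scale a x x' : tcong x x' -> tcong (TScale a x) (TScale a x')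
  | tcong_addA x y z : tcong (TAdd x (TAdd y z)) (TAdd (TAdd x y) z)
  | tcong_addC x y : tcong (TAdd x y) (TAdd y x)
  | tcong_add0 x : tcong (TAdd TZero x) x
  | tcong_addN x : tcong (TAdd (TOpp x) x) TZero
  | tcong_scaleA a b x : tcong (TScale a (TScale b x)) (TScale (a * b) x)
  | tcong_scale1 x : tcong (TScale 1 x) x
  | tcong_scaleDr a x y :
      tcong (TScale a (TAdd x y)) (TAdd (TScale a x) (TScale a y))
  | tcong_scaleDl a b x :
      tcong (TScale (a + b) x) (TAdd (TScale a x) (TScale b x))
  | tcong_pureDl f g u : tcong (TPure (f + g) u) (TAdd (TPure f u) (TPure g u))
  | tcong_pureDr f u v : tcong (TPure f (u + v)) (TAdd (TPure f u) (TPure f v))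
  | tcong_pureZ f (c : k) u : tcong (TPure (f * tofrac c) u) (TPure f (c *: u))
  | tcong_scale_pure a f u : tcong (TScale a (TPure f u)) (TPure (a * f) u).

Definition tcongb (x y : tterm) : bool := `[< tcong x y >].

Lemma tcongb_refl : reflexive tcongb.
Proof. by move=> x; apply/asboolP/tcong_refl. Qed.
Lemma tcongb_sym : symmetric tcongb.
Proof. by move=> x y; apply/asboolP/asboolP; apply: tcong_sym. Qed.
Lemma tcongb_trans : transitive tcongb.
Proof.
by move=> y x z /asboolP xy /asboolP yz; apply/asboolP; apply: tcong_trans yz.
Qed.

Canonical tcong_equiv := EquivRel tcongb tcongb_refl tcongb_sym tcongb_trans.

Definition frac_tensor : Type := {eq_quot tcong_equiv}.
HB.instance Definition _ := Choice.on frac_tensor.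
HB.instance Definition _ := Quotient.on frac_tensor.
HB.instance Definition _ := EqQuotient.on frac_tensor.

Local Notation cl := (\pi_frac_tensor).

Lemma frac_tensorP (x y : tterm) : tcong x y <-> cl x = cl y.
Proof.
split=> [xy|]; first by apply/eqmodP/asboolP.
by move=> /eqmodP /asboolP.
Qed.

Definition ft_add := lift_op2 frac_tensor TAdd.
Definition ft_opp := lift_op1 frac_tensor TOpp.
Definition ft_scale (a : F) := lift_op1 frac_tensor (TScale a).

Lemma tcong_repr x : tcong (repr (cl x)) x.
Proof. by apply/frac_tensorP; rewrite reprK. Qed.

Lemma ft_cl_add x y : ft_add (cl x) (cl y) = cl (TAdd x y).
Proof. by unlock ft_add; apply/frac_tensorP; apply: tcong_add; apply: tcong_repr. Qed.
Lemma ft_cl_opp x : ft_opp (cl x) = cl (TOpp x).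
Proof. by unlock ft_opp; apply/frac_tensorP; apply: tcong_opp; apply: tcong_repr. Qed.
Lemma ft_cl_scale a x : ft_scale a (cl x) = cl (TScale a x).
Proof. by unlock ft_scale; apply/frac_tensorP; apply: tcong_scale; apply: tcong_repr. Qed.

Let clE := (ft_cl_add, ft_cl_opp, ft_cl_scale).

Lemma ft_addA : associative ft_add.
Proof.
elim/quotW=> x; elim/quotW=> y; elim/quotW=> z; rewrite !clE.
by apply/frac_tensorP; apply: tcong_addA.
Qed.
Lemma ft_addC : commutative ft_add.
Proof.
by elim/quotW=> x; elim/quotW=> y; rewrite !clE; apply/frac_tensorP; apply: tcong_addC.
Qed.
Lemma ft_add0 : left_id (cl TZero) ft_add.
Proof. by elim/quotW=> x; rewrite !clE; apply/frac_tensorP; apply: tcong_add0. Qed.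
Lemma ft_addN : left_inverse (cl TZero) ft_opp ft_add.
Proof. by elim/quotW=> x; rewrite !clE; apply/frac_tensorP; apply: tcong_addN. Qed.

HB.instance Definition _ :=
  GRing.isZmodule.Build frac_tensor ft_addA ft_addC ft_add0 ft_addN.

Lemma ft_scaleA a b x : ft_scale a (ft_scale b x) = ft_scale (a * b) x.
Proof. by elim/quotW: x => x; rewrite !clE; apply/frac_tensorP; apply: tcong_scaleA. Qed.
Lemma ft_scale1 : left_id 1 ft_scale.
Proof. by elim/quotW=> x; rewrite !clE; apply/frac_tensorP; apply: tcong_scale1. Qed.
Lemma ft_scaleDr : right_distributive ft_scale +%R.
Proof.
move=> a; elim/quotW=> x; elim/quotW=> y.
by rewrite /GRing.add /= !clE; apply/frac_tensorP; apply: tcong_scaleDr.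
Qed.
Lemma ft_scaleDl x : {morph ft_scale^~ x : a b / a + b}.
Proof.
elim/quotW: x => x a b.
by rewrite [RHS]/GRing.add /= !clE; apply/frac_tensorP; apply: tcong_scaleDl.
Qed.

HB.instance Definition _ := GRing.Zmodule_isLmodule.Build F frac_tensor
  ft_scaleA ft_scale1 ft_scaleDr ft_scaleDl.

End FractionTensor.

(* 0 if V is infinite dimensional. *)
Definition fdim (F : fieldType) (V : lmodType F) : nat :=
  xget 0%N [set d : nat | inhabited (Vector.axiom d V)]%classic.

Definition module_rank (k : idomainType) (N : lmodType k) : nat :=
  fdim (frac_tensor N).

Section Span.
Variables (k : nzRingType) (A : lmodType k).

Definition span (S : set A) : {pred A} := fun x =>
  `[< exists s : seq (k * A),
        (forall p, p \in s -> S p.2) /\ x = \sum_(p <- s) p.1 *: p.2 >].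

Lemma span_submod (S : set A) : GRing.subsemimod_closed (span S).
Proof.
split; first split.
- by apply/asboolP; exists [::]; split; rewrite ?big_nil.
- move=> _ _ /asboolP[s [sS ->]] /asboolP[t [tS ->]]; apply/asboolP.
  exists (s ++ t); rewrite big_cat; split=> // p.
  by rewrite mem_cat => /orP[/sS|/tS].
move=> a _ /asboolP[s [sS ->]]; apply/asboolP.
exists [seq (a * p.1, p.2) | p <- s]; split; first by move=> _ /mapP[p /sS ? ->].
by rewrite big_map scaler_sumr; apply: eq_bigr => p _; rewrite scalerA.
Qed.

HB.instance Definition _ (S : set A) :=
  GRing.isSubmodClosed.Build k A (span S) (span_submod S).

Definition span_type (S : set A) : Type := {x : A | x \in span S}.
HB.instance Definition _ (S : set A) := SubChoice.on (span_type S).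
HB.instance Definition _ (S : set A) :=
  [SubChoice_isSubLmodule of span_type S by <:].

End Span.

Section GKdim.
Variables (R : realType) (k : idomainType) (A : pzAlgType k).

Definition gen_submod (W : {pred A}) : Prop :=
  [/\ exists s : seq A, W =i span [set` s]%classic,
      1 \in W
    & forall B : {pred A}, GRing.subring_closed B -> GRing.scaler_closed B ->
        {subset W <= B} -> B =i predT].

Definition products (W : {pred A}) (n : nat) : set A :=
  [set x | exists2 w : 'I_n -> A, (forall i, w i \in W) & x = \prod_(i < n) w i]%classic.

Definition growth (W : {pred A}) (n : nat) : nat :=
  module_rank (span_type (products W n)).

(* ln 0 = 0, which makes the Gelfand-Kirillov dimension of the zero algebra
   equal to 0. *)
Definition GKdim_of (W : {pred A}) : \bar R :=
  limn_esup (fun n : nat => (ln (growth W n)%:R / ln n%:R)%:E).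

(* The limit does not depend on the choice of W: "A is finitely generated and
   has dimension d" therefore asks for some W, and the value d for all W. *)
Definition has_GKdim (d : \bar R) : Prop :=
  (exists W, gen_submod W) /\ (forall W, gen_submod W -> GKdim_of W = d).

End GKdim.

(* Main.v *)
Require Import Defs.
From HB Require Import structures.
From mathcomp Require Import all_boot all_order all_algebra.
From mathcomp Require Import boolp classical_sets reals ereal sequences exp.
From mathcomp Require Import topology normedtype zify lra.
Import Defs.

(* Upper bound: the algebra is spanned by the monomials p q^* with p and q paths to
   the same vertex v.  A path of length at most m to v is determined, up to bounded
   choices, by the number of turns around each of the disjoint cycles it meets, so
   there are O(m^c) of them, c being the largest number of cycles on a path to v;
   this gives O(m^(2c)) monomials.  If v lies on a cycle without exits, (CK2) reads
   e e^* = s(e) there, so p and q may be assumed not to end with the same arrow of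
   that cycle, and the exponent drops to 2c - 1.

   Lower bound: a chain of cycles that realizes the height ends at a vertex w which
   is a sink or lies on a cycle C without exits.  The algebra acts on functions on
   the paths that end at w, respectively turn around C forever, where the turns
   around C are counted by an integer.  The matrix coefficients of this action
   separate the monomials p C^a q^* with p and q paths that visit w only at their
   end, and there are enough of them because the number of paths from the j-th cycle
   of the chain down to w satisfies the recursion of binomial coefficients. *)

Set Implicit Arguments.
Unset Strict Implicit.
Unset Printing Implicit Defensive.
Import Order.TTheory GRing.Theory Num.Theory.

(** * Counting paths *)

Lemma leq_pexp2r (m n e : nat) : m <= n -> m ^ e <= n ^ e.
Proof. by case: e => // e mn; rewrite leq_exp2r. Qed.

Section Paths.
Variable G : digraph.
Local Notation V := (vertex G).
Local Notation E := (arrow G).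
Local Notation leadsto := (connect (@adj G)).
Implicit Types (u v w x y : V) (e f : E) (p q : seq E).

Fixpoint is_path x p y : bool :=
  if p is e :: p' then (src e == x) && is_path (tgt e) p' y else x == y.

Lemma is_path_rcons x p e y :
  is_path x (rcons p e) y = is_path x p (src e) && (tgt e == y).
Proof.
by elim: p x => [|f p IH] x /=; [rewrite eq_sym|rewrite IH andbA].
Qed.

Lemma adj_arrow e : adj (src e) (tgt e).
Proof. by apply/existsP; exists e; rewrite !eqxx. Qed.

Lemma leadsto_arrow e : leadsto (src e) (tgt e).
Proof. exact/connect1/adj_arrow. Qed.

Lemma leadsto_ind (y : V) (P : V -> Prop) :
  P y -> (forall e, leadsto (tgt e) y -> P (tgt e) -> P (src e)) ->
  forall x, leadsto x y -> P x.
Proof.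
move=> Py IH x /connectP[p]; elim: p x => [|z p IHp] x /=; first by move=> _ <-.
case/andP=> /existsP[e /andP[/eqP<- /eqP<-]] pP lastp.
apply: IH; last exact: IHp.
by apply/connectP; exists p.
Qed.

(** The start of the path is left free and the recursion removes the last arrow, because the upper
    bound distinguishes paths by the arrow through which they enter [v]. *)
Fixpoint paths_to m v : seq (seq E) :=
  if m is m'.+1 then
    [::] :: flatten [seq [seq rcons p e | p <- paths_to m' (src e)]
                    | e <- enum E & tgt e == v]
  else [:: [::]].

Lemma mem_paths_to m x p v : is_path x p v -> size p <= m -> p \in paths_to m v.
Proof.
elim: m p v => [|m IH] p v; first by rewrite leqn0 size_eq0 => _ /eqP->.
case/lastP: p => [|p e]; first by rewrite mem_head.
rewrite is_path_rcons size_rcons ltnS => /andP[pP te] pm.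
rewrite inE; apply/orP; right; apply/flatten_mapP; exists e.
  by rewrite mem_filter te mem_enum.
by apply: map_f; apply: IH.
Qed.

Lemma size_flatten_enum (T : Type) (P : pred E) (F : E -> seq T) :
  size (flatten [seq F e | e <- enum E & P e]) = \sum_(e | P e) size (F e).
Proof.
rewrite size_flatten sumnE /shape -map_comp big_map big_filter big_enum_cond.
by [].
Qed.

(* Paths from [x] to [w] that visit [w] only at their end; [m] bounds the length. *)
Fixpoint first_paths w m x : seq (seq E) :=
  if x == w then [:: [::]] else
  if m is m'.+1 then
    flatten [seq [seq e :: p | p <- first_paths w m' (tgt e)]
            | e <- enum E & src e == x]
  else [::].

Lemma first_paths_end w m : first_paths w m w = [:: [::]].
Proof. by case: m => [|m] /=; rewrite eqxx. Qed.

Lemma size_first_pathsS w m x : x != w ->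
  size (first_paths w m.+1 x) =
  \sum_(e | src e == x) size (first_paths w m (tgt e)).
Proof.
move=> /negPf /= ->; rewrite size_flatten_enum.
by apply: eq_bigr => e _; rewrite size_map.
Qed.

Lemma mem_first_paths w m x p : p \in first_paths w m x ->
  [/\ is_path x p w, all (fun e => src e != w) p & size p <= m].
Proof.
elim: m x p => [|m IH] x p /=.
  by case: eqP => // -> ; rewrite inE => /eqP-> /=; rewrite eqxx.
case: eqP => [->|/eqP xw]; first by rewrite inE => /eqP-> /=; rewrite eqxx.
case/flatten_mapP => e; rewrite mem_filter => /andP[/eqP se _] /mapP[q /IH[h1 h2 h3] ->].
by split=> //=; rewrite se ?eqxx ?xw.
Qed.

Lemma first_paths_uniq w m x : uniq (first_paths w m x).
Proof.
elim: m x => [|m IH] x /=; first by case: eqP.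
case: eqP => // _; elim: (enum E) (enum_uniq E) => //= e s IHs /andP[es us].
case: ifP => _; last exact: IHs.
rewrite /= cat_uniq IHs // andbT map_inj_uniq ?IH /=; last by move=> p q [].
apply/hasPn => q0 /flatten_mapP[f]; rewrite mem_filter => /andP[_ fs] /mapP[q _ ->{q0}].
by apply/mapP => -[q' _ [] fe _]; move: es; rewrite -fe fs.
Qed.

Lemma first_paths_le w m n x : m <= n ->
  size (first_paths w m x) <= size (first_paths w n x).
Proof.
have [->|xw] := eqVneq x w; first by rewrite !first_paths_end.
elim: m n x xw => [|m IH] [|n] x xw //; first by rewrite /= (negPf xw).
rewrite ltnS => mn; rewrite !size_first_pathsS //; apply: leq_sum => e _.
have [->|ew] := eqVneq (tgt e) w; first by rewrite !first_paths_end.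
exact: IH.
Qed.

Lemma first_paths_arrow w m e : src e != w ->
  size (first_paths w m (tgt e)) <= size (first_paths w m.+1 (src e)).
Proof. by move=> sw; rewrite size_first_pathsS // (bigD1 e) //= leq_addr. Qed.

(** Prepending a fixed path of length [l] from [x] to [y] keeps the visit to [w] at the end unless
    that path meets [w]. In that case [w] leads to [y], so [y = w], and both lists consist of the
    empty path. *)
Lemma first_paths_leadsto w x y : leadsto x y -> y = w \/ ~~ leadsto w y ->
  exists l, forall m, size (first_paths w m y) <= size (first_paths w (l + m) x).
Proof.
move=> xy yw; move: x xy; apply: leadsto_ind => [|e ey [l IH]]; first by exists 0.
have [sw|sw] := eqVneq (src e) w; last first.
  by exists l.+1 => m; apply: leq_trans (IH m) (first_paths_arrow _ sw).
have {yw}-> : y = w.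
  case: yw => // /negP[]; rewrite -sw.
  by apply: connect_trans ey; apply: leadsto_arrow.
by exists 0 => m; rewrite sw !first_paths_end.
Qed.

(** At [src f] a path either goes once more around the cycle through [f] or leaves through [e]
    towards [u']. The two choices are the two terms of Pascal's rule. *)
Lemma first_paths_loop w u' d K e f : e != f -> src e = src f -> src f != w ->
  leadsto (tgt f) (src f) -> ~~ leadsto w (src f) ->
  leadsto (tgt e) u' -> u' = w \/ ~~ leadsto w u' ->
  (forall j, 'C(j, d) <= size (first_paths w (K * j) u')) ->
  exists K', forall j, 'C(j, d.+1) <= size (first_paths w (K' * j) (src f)).
Proof.
move=> ef sef sw fu wu eu' u'w IH.
have [l1 H1] := first_paths_leadsto fu (or_intror wu).
have [l2 H2] := first_paths_leadsto eu' u'w.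
(* One unit of [j] has to pay for the first arrow, then either for the [l1] steps back to [src f],
   or for the [l2] steps to [u']. *)
exists (K + l1 + l2).+1; elim=> [|j IHj] //.
rewrite binS mulnS addSn size_first_pathsS //.
rewrite (bigD1 f) //= (bigD1 e) /= ?sef ?eqxx // addnA.
apply: leq_trans (leq_addr _ _); apply: leq_add.
  apply: leq_trans IHj _; apply: leq_trans (H1 _) _.
  by apply: first_paths_le; lia.
apply: leq_trans (IH j) _; apply: leq_trans (H2 _) _.
by apply: first_paths_le; lia.
Qed.

End Paths.

(** * Arrows on cycles and heights of vertices *)

Section Heights.
Variable G : digraph.
Hypothesis dis : disjoint_cycles G.
Local Notation V := (vertex G).
Local Notation E := (arrow G).
Local Notation leadsto := (connect (@adj G)).
Implicit Types (u v w x y : V) (e f : E) (p q : seq E).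

(** These are exactly the arrows lying on some cycle: a return path without repeated vertices closes
    [e] up to a cycle. *)
Definition back e : bool := leadsto (tgt e) (src e).
Definition cyclic v : bool := [exists e, (src e == v) && back e].

Lemma back_cycle e : back e -> exists c : cyc G, e \in (val (val c) : seq E).
Proof.
case/connectP=> p0 p0P last0.
case/shortenP: p0P last0 => p pP Up _ lastp.
have [q [sq tq qP]] := path_arrows pP.
have cq : is_cycle (e :: q).
  apply/and3P; split=> //=.
    have: (last (tgt e) [seq tgt f | f <- q]) == src e by rewrite tq -lastp.
    rewrite last_map rcons_path => ->; rewrite andbT.
    case: q sq qP {tq} => [|f q] //=.
    by case: p {pP Up lastp} => [|w p] //= [-> _] ->; rewrite eqxx.
  by rewrite sq; have := Up; rewrite lastI rcons_uniq -lastp.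
by exists (exist _ (Bseq (size_cycle cq)) cq); rewrite /= mem_head.
Qed.

Lemma cycle_back (c : seq E) e : is_cycle c -> e \in c -> back e.
Proof.
move=> cc ec; apply: (cycle_connect cc); first exact: tgt_in_cycle.
exact: map_f.
Qed.

Lemma cycle_src_inj (c : seq E) : is_cycle c -> {in c &, injective (@src G)}.
Proof.
case/and3P=> _ _ Uc e f ec fc.
have := Uc; rewrite -[uniq _]/(uniq (map (@src G) c)).
move=> U se; have h := nth_index e; have ie := h _ _ ec; have i_f := h _ _ fc.
have /eqP : nth (src e) (map (@src G) c) (index e c) = nth (src e) (map (@src G) c) (index f c).
  by rewrite !(nth_map e) ?index_mem // ie i_f.
by rewrite nth_uniq ?size_map ?index_mem // => /eqP ief; rewrite -ie ief i_f.
Qed.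

(** If [f] were not on the cycle of [e], closing it up would give a second cycle through the same
    vertex. *)
Lemma back_src_inj e f : back e -> back f -> src e = src f -> e = f.
Proof.
move=> be bf sef; have [c ec] := back_cycle be.
apply: (cycle_src_inj (valP c)) => //.
apply: return_arrow => //; first exact: (valP c).
by rewrite -sef map_f.
Qed.

(** Both arrows lie on one cycle, where their successors have the same source and hence coincide;
    [next] is injective on a cycle. *)
Lemma back_tgt_inj e f : back e -> back f -> tgt e = tgt f -> e = f.
Proof.
move=> be bf tef; have [c ec] := back_cycle be; have cc := valP c.
have fc : f \in (val (val c) : seq E).
  apply: return_arrow => //.
  apply: (@return_vertex _ dis _ (tgt f) _ (tgt f)) => //.
  - by rewrite -tef; apply: tgt_in_cycle.
  - by rewrite -tef; apply: tgt_in_cycle.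
  - exact: leadsto_arrow.
have /and3P[_ cyc_c Uc] := cc.
have := next_cycle cyc_c ec; have := next_cycle cyc_c fc.
rewrite -tef => /eqP-> /eqP nn.
have := cycle_src_inj cc _ _ nn; rewrite !mem_next => /(_ fc ec) /(congr1 (prev (val (val c)))).
by rewrite !prev_next ?(map_uniq Uc).
Qed.

Lemma cyclic_tgt e : back e -> cyclic (tgt e).
Proof.
move=> be; have [c ec] := back_cycle be.
have /mapP[f fc tf] := tgt_in_cycle (valP c) ec.
by apply/existsP; exists f; rewrite tf eqxx (cycle_back (valP c)).
Qed.

Lemma cyclic_src e : back e -> cyclic (src e).
Proof. by move=> be; apply/existsP; exists e; rewrite eqxx. Qed.

Lemma cyclicP v : cyclic v -> exists c : cyc G, v \in [seq src e | e <- val (val c)].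
Proof.
by case/existsP=> e /andP[/eqP<- /back_cycle[c ec]]; exists c; apply: map_f.
Qed.

(** The condition covers every vertex reachable from [v], so that it can be used all along a path
    starting at [v]. *)
Definition exitless v : bool := cyclic v &&
  [forall e, [forall f, leadsto v (src e) && (src e == src f) ==> (e == f)]].

Lemma exitlessP v e f : exitless v -> leadsto v (src e) -> src e = src f -> e = f.
Proof.
case/andP=> _ /forallP/(_ e)/forallP/(_ f) h ve sef.
by apply/eqP; move: h; rewrite ve sef eqxx.
Qed.

Lemma cycle_exitless (c : cyc G) v : ~~ has_exit (val (val c)) ->
  v \in [seq src e | e <- val (val c)] -> exitless v.
Proof.
move=> ne vc; have cc := valP c.
have ex e f : f \in (val (val c) : seq E) -> src e = src f -> e = f.
  move=> fc sef; apply/eqP/negPn/negP => ef; case/negP: ne.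
  by apply/existsP; exists e; apply/existsP; exists f; rewrite fc sef eqxx.
have closed w : leadsto v w -> w \in [seq src e | e <- val (val c)].
  case/connectP=> p; elim: p v vc => [|z p IH] v vc /=; first by move=> _ ->.
  case/andP=> /existsP[e /andP[/eqP sv /eqP tz]]; apply: IH.
  rewrite -tz; apply: tgt_in_cycle => //.
  by case/mapP: vc => f fc vf; rewrite (ex e f) // sv.
apply/andP; split.
  case/mapP: vc => e ec ->; apply: cyclic_src; exact: cycle_back ec.
apply/forallP=> e; apply/forallP=> f; apply/implyP => /andP[/closed /mapP[g gc eg] /eqP sef].
by rewrite (ex e g) // (ex f g) // -sef.
Qed.

(** This extends the height to vertices off the cycles. It never increases along an arrow, so it can
    be followed along a path. *)
Definition vheight v : nat :=
  \max_(x : node G | has (leadsto v) (node_vertices x)) height x.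

Lemma vheight_ge v (x : node G) w : w \in node_vertices x -> leadsto v w ->
  height x <= vheight v.
Proof.
move=> wx vw; rewrite /vheight.
apply: (bigop.bigmax_sup x) => //.
by apply/hasP; exists w.
Qed.

Lemma vheight_le u v : leadsto u v -> vheight v <= vheight u.
Proof.
move=> uv; apply/bigop.bigmax_leqP => x /hasP[w wx vw].
by apply: (vheight_ge wx); apply: connect_trans vw.
Qed.

Lemma vheight_graph v : vheight v <= graph_height G.
Proof.
apply/bigop.bigmax_leqP => -[s _|c _]; first by rewrite height_sink.
rewrite /graph_height; exact: (bigop.bigmax_sup c).
Qed.

Lemma cycle_nonexit (c : cyc G) e f : f \in (val (val c) : seq E) ->
  src e = src f -> ~~ back e -> has_exit (val (val c)).
Proof.
move=> fc sef nb; apply/existsP; exists e; apply/existsP; exists f.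
rewrite fc sef eqxx /=; apply: contraNneq nb => ->.
exact: cycle_back (valP c) fc.
Qed.

Lemma below_exit (c : cyc G) e (x : node G) w :
  src e \in [seq src f | f <- val (val c)] -> ~~ back e ->
  w \in node_vertices x -> leadsto (tgt e) w ->
  leads (inr c) x && ~~ same_node (inr c) x.
Proof.
move=> ec nb wx ew; apply/andP; split.
  apply/leadsP; exists (src e), w; split=> //.
  exact: connect_trans (leadsto_arrow e) ew.
apply: contra nb; case: x wx => //= d wd cd; apply: connect_trans ew _.
apply: (cycle_connect (valP d)) => //.
case/mapP: ec => f fc ->; apply: map_f.
by rewrite -(rotation_mem cd).
Qed.

(** Any sink or cycle reached from [tgt e] lies strictly below the cycle of [src e], since otherwise
    [e] could be closed up. The recursion for the height then contributes the 2. *)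
Lemma vheight_exit e : cyclic (src e) -> ~~ back e ->
  vheight (tgt e) + 2 <= vheight (src e).
Proof.
case/existsP=> f /andP[/eqP sfe bf] nb; have [c fc] := back_cycle bf.
have exc : has_exit (val (val c)) by apply: cycle_nonexit fc _ nb; rewrite sfe.
have ec : src e \in [seq src f | f <- val (val c)] by rewrite -sfe map_f.
apply: leq_trans (vheight_ge (x := inr c) ec (connect0 _ _)).
rewrite height_exit // addnC leq_add2l; apply/bigop.bigmax_leqP => x /hasP[w wx ew].
apply: (bigop.bigmax_sup x) => //.
exact: below_exit ew.
Qed.

Lemma vheight_cyclic v : cyclic v -> (if exitless v then 1 else 2) <= vheight v.
Proof.
move=> cv; have [c vc] := cyclicP cv.
apply: leq_trans (vheight_ge (x := inr c) vc (connect0 _ _)).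
case: (boolP (has_exit (val (val c)))) => ex.
  by rewrite height_exit //; case: ifP.
by rewrite (cycle_exitless ex vc) height_no_exit.
Qed.

(** An arrow that is not on a cycle strictly shrinks the set of reachable vertices, so following
    arrows ends at a sink or at a cycle. *)
Lemma leads_to_node v : exists (x : node G) w, w \in node_vertices x /\ leadsto v w.
Proof.
move: {2}#|_|.+1 (ltnSn #|[pred w | leadsto v w]|) => n.
elim: n v => // n IH v vn.
case: (boolP (sink v)) => [sv|/forallPn[e]].
  by exists (inl (exist _ v sv)), v; rewrite /= mem_head connect0.
rewrite negbK => /eqP sv.
case: (boolP (back e)) => [/back_cycle[c ec]|nb].
  by exists (inr c), (src e); rewrite -sv connect0; split=> //; apply: map_f.
have [|x [w [wx ew]]] := IH (tgt e).
  rewrite -ltnS; apply: leq_trans vn; rewrite ltnS; apply: proper_card; apply/properP; split.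
    apply/fintype.subsetP=> w; rewrite !inE -sv; apply: connect_trans.
    exact: leadsto_arrow.
  by exists v; rewrite !inE ?connect0 // -sv.
exists x, w; split=> //; rewrite -sv; apply: connect_trans ew; exact: leadsto_arrow.
Qed.

Lemma leave_set (P : pred V) u w : leadsto u w -> P u -> ~~ P w ->
  exists e, [/\ P (src e), ~~ P (tgt e) & leadsto (tgt e) w].
Proof.
move=> uw + nw; move: u uw; apply: leadsto_ind => [Pw|e ew IH Pe].
  by rewrite Pw in nw.
by case: (boolP (P (tgt e))) => [/IH//|nP]; exists e.
Qed.

(* [w] is the end of a chain of cycles that realizes the height of [x], and [d]
   is the number of cycles with exits in that chain. *)
Lemma height_first_paths (x : node G) : exists u w d K (b : bool),
  [/\ [/\ u \in node_vertices x, leadsto u w & u = w \/ ~~ leadsto w u],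
    height x = 2 * d + b, if b then exitless w else sink w &
    forall j, 'C(j, d) <= size (first_paths w (K * j) u)].
Proof.
move: {2}(height x).+1 (ltnSn (height x)) => n; elim: n x => // n IH [s|c] xn.
  exists (val s), (val s), 0, 0, false; rewrite height_sink; split=> //.
  - by split=> //; [apply: mem_head|left].
  - exact: valP s.
  - by move=> j; rewrite first_paths_end bin0.
case: (boolP (has_exit (val (val c)))) => ex; last first.
  have [u uc] : exists u, u \in [seq src e | e <- val (val c)].
    have /and3P[c0 _ _] := valP c.
    by case: (val (val c) : seq E) (c0 : val (val c) != [::] :> seq E) => // e s _; exists (src e); rewrite mem_head.
  exists u, u, 0, 0, true; rewrite height_no_exit //; split=> //.
  - by split=> //; left.
  - exact: cycle_exitless uc.
  - by move=> j; rewrite first_paths_end bin0.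
pose B := [pred y : node G | leads (inr c) y && ~~ same_node (inr c) y].
(* The maximum in the height of [c] is attained only over a nonempty set; the target of an exit
   leads to a member of it. *)
have B0 : 0 < #|B|.
  have /existsP[e /existsP[f /and3P[fc /eqP sef ef]]] := ex.
  have ec : src e \in [seq src f | f <- val (val c)] by rewrite sef map_f.
  have nb : ~~ back e.
    apply: contra ef => be; apply/eqP; apply: back_src_inj => //.
    exact: cycle_back (valP c) fc.
  have [x [w [wx ew]]] := leads_to_node (tgt e).
  by apply/card_gt0P; exists x; apply: below_exit ew.
have [y /andP[cy ncy] ymax] := bigop.eq_bigmax_cond (fun y : node G => height y) B0.
move: xn; rewrite height_exit // [X in 2 + X]ymax => xn.
have [|u' [w [d [K [b [[u'y u'w u'w'] hy wb IHj]]]]]] := IH y; first by lia.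
have yc : ~ leads y (inr c) by move=> yc; case/negP: ncy; apply: leads_anti.
have u'c : u' \notin [seq src e | e <- val (val c)].
  by apply/negP => u'c; apply: yc; apply/leadsP; exists u', u'.
have /leadsP[u1 [w1 [u1c w1y uw1]]] := cy.
have u1u' := connect_trans uw1 (node_connect w1y u'y).
(* The arrow by which a path to [u'] leaves the cycle serves as the exit, and [f] is the arrow of
   the cycle with the same source. *)
have [e [ec nec eu']] := leave_set (P := mem [seq src e | e <- val (val c)]) u1u' u1c u'c.
case/mapP: (ec) => f fc sef.
have wf : ~~ leadsto w (src f).
  apply/negP => wf; apply: yc; apply/leadsP; exists u', (src f); split=> //.
    exact: map_f.
  exact: connect_trans wf.
have tf := tgt_in_cycle (valP c) fc.
have [|||||K' HK'] := @first_paths_loop _ w u' d K e f _ _ _ _ _ eu' u'w' IHj.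
- by apply: contraNneq nec => ->.
- by [].
- by apply: contraNneq wf => ->; rewrite connect0.
- exact: cycle_back (valP c) fc.
- by [].
exists (src f), w, d.+1, K', b; split=> //.
- split; first exact: map_f.
    by rewrite -sef; apply: connect_trans (leadsto_arrow e) (connect_trans eu' u'w).
  by right.
- by rewrite hy mulnS addnA.
Qed.

End Heights.

(** * Polynomial bounds for the number of paths *)

Section UpperCount.
Variable G : digraph.
Hypothesis dis : disjoint_cycles G.
Local Notation V := (vertex G).
Local Notation E := (arrow G).
Local Notation leadsto := (connect (@adj G)).
Local Notation H := (graph_height G).
Implicit Types (u v w x y : V) (e f : E) (p q : seq E).

(** The last arrow is not on a cycle, so the cycle of [v] itself costs no factor. Lengths up to
    [m + 1] are allowed, which makes [size_paths_toS] an equality. *)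
Definition entering_paths m v : seq (seq E) :=
  [::] :: flatten [seq [seq rcons p e | p <- paths_to m (src e)]
                  | e <- enum E & (tgt e == v) && ~~ back e].

Lemma mem_entering_paths m x p v : is_path x p v -> size p <= m ->
  (forall q e, p = rcons q e -> ~~ back e) -> p \in entering_paths m v.
Proof.
case/lastP: p => [|p e]; first by rewrite mem_head.
rewrite is_path_rcons size_rcons => /andP[pP te] pm /(_ p e erefl) nb.
rewrite inE; apply/orP; right; apply/flatten_mapP; exists e.
  by rewrite mem_filter te nb mem_enum.
by apply: map_f; apply: mem_paths_to pP (ltnW pm).
Qed.

Lemma size_entering m v : size (entering_paths m v) =
  1 + \sum_(e | (tgt e == v) && ~~ back e) size (paths_to m (src e)).
Proof.
rewrite /= size_flatten_enum; congr _.+1.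
by apply: eq_bigr => e _; rewrite size_map.
Qed.

Lemma size_paths_toS m v : size (paths_to m.+1 v) = size (entering_paths m v) +
  \sum_(e | (tgt e == v) && back e) size (paths_to m (src e)).
Proof.
rewrite size_entering /= size_flatten_enum add1n addSn; congr _.+1.
rewrite [LHS](bigID (@back G)) addnC /=; congr (_ + _);
  by apply: eq_bigr => e _; rewrite size_map.
Qed.

(* Going up through a cycle with exits raises the height by 2, so a path to [v]
   meets at most [level v] cycles before it reaches [v] or the cycle of [v]. *)
Definition level v := (H - vheight v)./2.

(** Leaving a cycle drops [vheight] by at least 2, hence raises [level] by at least 1, the exponent
    that the turns around this cycle cost. *)
Lemma level_arrow e : ~~ back e -> level (src e) + cyclic (src e) <= level (tgt e).
Proof.
move=> nb; rewrite /level; have := vheight_graph (src e).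
have := vheight_le (leadsto_arrow e).
case: (boolP (cyclic (src e))) => [/(vheight_exit dis)/(_ nb)|_] /=; lia.
Qed.

Lemma level_leadsto u v : leadsto u v -> leadsto v u -> level u = level v.
Proof.
move=> uv vu; rewrite /level; congr (_ - _)./2.
by apply/eqP; rewrite eqn_leq !vheight_le.
Qed.

(** Induction on the number of vertices leading to [v]: it is smaller at [src e] when [e] ends at
    [v] and is not on a cycle. If [v] is on a cycle, walking backwards along it stays at one level;
    each of the at most [m] steps adds one count of entering paths, and this sum raises the exponent
    by 1. *)
Lemma path_count : exists K, forall m v,
  size (entering_paths m v) <= K * m.+1 ^ level v /\
  size (paths_to m v) <= K * m.+1 ^ (level v + cyclic v).
Proof.
pose anc v := #|[pred u | leadsto u v]|.
suff [K HK] : exists K, forall v, anc v < #|V|.+1 -> forall m,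
  size (entering_paths m v) <= K * m.+1 ^ level v /\
  size (paths_to m v) <= K * m.+1 ^ (level v + cyclic v).
  by exists K => m v; apply: HK; rewrite ltnS max_card.
elim: #|V|.+1 => [|n [K HK]]; first by exists 0.
have ent v : anc v < n.+1 -> forall m,
    size (entering_paths m v) <= (1 + #|E| * K) * m.+1 ^ level v.
  move=> vn m; rewrite size_entering mulnDl; apply: leq_add.
    by rewrite mul1n expn_gt0.
  rewrite -mulnA -sum_nat_const [leqLHS]big_mkcond /=; apply: leq_sum => e _.
  case: ifP => // /andP[/eqP te nb].
  have [|_] := HK (src e) _ m.
    rewrite -ltnS; apply: leq_trans vn; rewrite ltnS; apply: proper_card; apply/properP; split.
      apply/fintype.subsetP=> w; rewrite !inE -te => /connect_trans; apply.
      exact: leadsto_arrow.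
    by exists v; rewrite !inE ?connect0 // -te.
  move/leq_trans; apply; rewrite leq_mul2l leq_pexp2l ?orbT //.
  by rewrite -te level_arrow.
exists (1 + #|E| * K) => v vn m; split; first exact: ent.
case: (boolP (cyclic v)) => cv /=; last first.
  case: m => [|m]; first by rewrite /= exp1n; lia.
  rewrite size_paths_toS [X in _ + X]big1 ?addn0 => [|e /andP[/eqP te be]]; last first.
    by rewrite -te (cyclic_tgt be) in cv.
  apply: leq_trans (ent _ vn _) _.
  by rewrite leq_mul2l leq_pexp2r ?orbT.
elim: m v vn cv => [|m IH] v vn cv; first by rewrite /= exp1n; lia.
(* The first summand pays for the entering paths, the second for the paths that arrive along the
   cycle. *)
have E1 : m.+2 ^ (level v + 1) = m.+2 ^ level v + m.+1 * m.+2 ^ level v.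
  by rewrite addn1 expnS mulSn.
rewrite size_paths_toS E1 mulnDr; apply: leq_add.
  apply: leq_trans (ent _ vn _) _.
  by rewrite leq_mul2l leq_pexp2r ?orbT.
(* By disjointness at most one arrow on a cycle ends at [v], so the sum has at most one term. *)
case: (pickP [pred e | (tgt e == v) && back e]) => [e /andP[/eqP te be]|none]; last first.
  by rewrite big_pred0.
rewrite (big_pred1 e) => [|f]; last first.
  apply/andP/eqP => [[/eqP tf bf]|->]; last by rewrite te.
  by apply: (back_tgt_inj dis); rewrite ?te ?tf.
have ev : leadsto (src e) v by rewrite -te; apply: leadsto_arrow.
have ve : leadsto v (src e) by rewrite -te.
apply: leq_trans (IH (src e) _ _) _.
- apply: leq_ltn_trans vn; apply: subset_leq_card; apply/fintype.subsetP=> w.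
  by rewrite !inE => we; apply: connect_trans ev.
- exact: cyclic_src.
rewrite (level_leadsto ev ve) addn1 expnS leq_mul2l leq_mul2l.
by rewrite leq_pexp2r ?orbT.
Qed.

End UpperCount.

Local Open Scope ring_scope.
Local Open Scope quotient_scope.

(** * Limit superior of logarithmic growth *)

Lemma limn_esup_eq (R : realType) (u : nat -> R) (d : R) :
  (forall e, 0 < e -> exists N, forall n, (N <= n)%N -> u n <= d + e) ->
  (forall e N, 0 < e -> exists2 n, (N <= n)%N & d - e <= u n) ->
  limn_esup (fun n => (u n)%:E) = d%:E.
Proof.
move=> ub lb; rewrite limn_esup_lim; apply/eqP; rewrite eq_le; apply/andP; split.
  apply/lee_addgt0Pr => e e0; have [N uN] := ub e e0.
  apply: lime_le; first exact: is_cvg_esups.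
  exists N => // n /= Nn; apply: ge_ereal_sup => _ [m /= nm <-].
  by rewrite -EFinD lee_fin; apply: uN; apply: leq_trans nm.
apply/lee_addgt0Pr => e e0; rewrite -leeBlDr // -EFinB.
apply: lime_ge; first exact: is_cvg_esups.
apply: nearW => N /=; have [n Nn un] := lb e N e0.
apply: (@le_trans _ _ (u n)%:E); first by rewrite lee_fin.
by apply: ereal_sup_ubound; exists n.
Qed.

Lemma ln_nat_large (R : realType) (c : R) :
  exists2 N, (1 < N)%N & forall n, (N <= n)%N -> c <= ln n%:R.
Proof.
pose M := (Num.Def.archi_bound (expR c)).
exists (M.+2) => // n Mn.
have e0 := expR_gt0 c.
rewrite -(expRK c) ler_ln ?posrE //; last by rewrite ltr0n; apply: leq_trans Mn.
apply: ltW; apply: lt_le_trans (archi_boundP (ltW e0)) _.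
by rewrite ler_nat; apply: leq_trans Mn; rewrite /M; do 2 apply: leqW.
Qed.

(** A limit superior is bounded below along any subsequence, so lower bounds at the multiples of [K]
    suffice. For [d = 0] the lower bound is just that [ln] is nonnegative on natural numbers. *)
Lemma limn_esup_log_growth (R : realType) (g : nat -> nat) (d K : nat) :
  (forall n, g n <= K * n.+1 ^ d)%N ->
  (0 < K)%N -> (forall j, 0 < d -> 0 < j -> j ^ d <= g (K * j))%N ->
  limn_esup (fun n => (ln (g n)%:R / ln n%:R)%:E) = d%:R%:E :> \bar R.
Proof.
move=> ub K0 lb.
have lnmono (a b : nat) : (0 < a)%N -> (a <= b)%N -> ln a%:R <= ln b%:R :> R.
  move=> a0 ab; rewrite ler_ln ?posrE ?ltr0n ?ler_nat //; exact: leq_trans ab.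
have lnpos (a : nat) : (0 <= ln a%:R :> R).
  case: a => [|a]; first by rewrite ln0.
  by rewrite ln_ge0 // ler1n.
have lnMX (a b : nat) : (0 < a)%N -> (0 < b)%N ->
    ln (a * b ^ d)%:R = ln a%:R + ln b%:R * d%:R :> R.
  move=> a0 b0; rewrite natrM lnM ?posrE ?ltr0n ?expn_gt0 ?b0 //.
  by rewrite natrX lnXn ?ltr0n // mulr_natr.
apply: limn_esup_eq => e.
  (* From [n + 1 <= 2 n] comes the factor [2 ^ d]; for [n >= N] the logarithm of the whole constant
     is at most [e * ln n]. *)
  move=> e0; have [N N1 HN] := ln_nat_large (ln (K * 2 ^ d)%:R / e : R).
  exists N => n Nn; have n1 := leq_trans N1 Nn; have n0 := ltnW n1.
  have lnn : 0 < ln n%:R :> R by rewrite ln_gt0 // ltr1n.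
  rewrite ler_pdivrMr //; apply: le_trans (_ : ln (K * 2 ^ d * n ^ d)%:R <= _).
    (* Monotonicity of [ln] needs a positive argument, so the default [ln 0 = 0] is treated
       apart. *)
    case: (posnP (g n)) => [->|g0]; first by rewrite ln0 //; apply: lnpos.
    apply: lnmono => //; apply: leq_trans (ub n) _.
    by rewrite -mulnA -expnMn leq_mul2l leq_pexp2r ?orbT //; lia.
  rewrite lnMX ?muln_gt0 ?K0 ?expn_gt0 //.
  have := HN n Nn; rewrite ler_pdivrMr //; lra.
(* Evaluating at [K * j] instead of [j] loses [d * ln K], which is at most [e * ln j] once
   [j >= M]. *)
move=> N e0; have [M M1 HM] := ln_nat_large (ln K%:R * d%:R / e : R).
exists (K * (M + N))%N; first by nia.
have j0 : (0 < M + N)%N by lia.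
have lnn : 0 < ln (K * (M + N))%:R :> R by rewrite ln_gt0 // ltr1n; nia.
rewrite ler_pdivlMr //; case: (posnP d) => [d0|d0].
  by rewrite d0 sub0r; apply: le_trans (lnpos _); rewrite mulNr oppr_le0 mulr_ge0 // ltW.
apply: le_trans (lnmono _ _ _ (lb _ d0 j0)); rewrite ?expn_gt0 ?j0 //.
have -> : ln (K * (M + N))%:R = ln K%:R + ln (M + N)%:R :> R.
  by rewrite natrM lnM ?posrE ?ltr0n.
have := lnMX 1%N (M + N)%N isT j0; rewrite mul1n => ->; rewrite ln1 add0r.
have lm : ln K%:R * d%:R <= ln (M + N)%:R * e.
  by rewrite -ler_pdivrMr //; apply: HM; apply: leq_addr.
have := lnpos K => lK; have : 0 <= e * ln K%:R by rewrite mulr_ge0 // ltW.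
lra.
Qed.

(** * Rank of a module over a domain *)

Definition independent (k : nzRingType) (U : lmodType k) n (x : 'I_n -> U) :=
  forall c : 'I_n -> k, \sum_i c i *: x i = 0 -> forall i, c i = 0.

Lemma wide_kernel (F : fieldType) n d (A : 'M[F]_(n, d)) : (d < n)%N ->
  exists2 c : 'I_n -> F, exists i, c i != 0 &
    forall j, \sum_i c i * A i j = 0.
Proof.
move=> dn; have : kermx A != 0.
  rewrite kermx_eq0 /row_free; apply/negP => /eqP rA.
  by have := rank_leq_col A; rewrite rA leqNgt dn.
case/rowV0Pn => v /sub_kermxP vA v0; exists (v 0) => [|j].
  by have [i vi] := rV0Pn v v0; exists i.
by have /rowP/(_ j) := vA; rewrite !mxE.
Qed.

Section Dimension.
Variables (F : fieldType) (U : lmodType F).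

Lemma independent_le_dim d n (x : 'I_n -> U) :
  inhabited (Vector.axiom d U) -> independent x -> (n <= d)%N.
Proof.
move=> [[f lf [g fK gK]]] ix; rewrite leqNgt; apply/negP => dn.
have [c [i ci] cA] := wide_kernel (\matrix_(i, j) f (x i) 0 j) dn.
pose fl := GRing.isLinear.Build F U 'rV[F]_d *:%R f lf.
pose f' : {linear U -> 'rV[F]_d} := HB.pack f fl.
case/eqP: ci; apply: ix; apply: (can_inj fK).
have -> : f (\sum_i c i *: x i) = \sum_i c i *: f (x i).
  rewrite -[f]/(f' : U -> _) linear_sum; apply: eq_bigr => j _; exact: linearZ.
have -> : f 0 = 0 by exact: (linear0 f').
apply/rowP => j; rewrite summxE mxE -[RHS](cA j); apply: eq_bigr => l _.
by rewrite !mxE.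
Qed.

(** An independent family of maximal size is a basis, and its coordinate functions provide the
    isomorphism with row vectors. *)
Lemma finite_dim_exists s :
  (forall n (x : 'I_n -> U), independent x -> (n <= s)%N) ->
  exists d, inhabited (Vector.axiom d U).
Proof.
move=> bnd.
pose P n := `[< exists x : 'I_n -> U, independent x >].
have P0 : exists n, P n by exists 0%N; apply/asboolP; exists (fun=> 0) => c _ [].
have Ps n : P n -> (n <= s)%N by move=> /asboolP[x]; apply: bnd.
case: (ex_maxnP P0 Ps) => d /asboolP[x ix] dmax.
have gen u : exists c : 'I_d -> F, u = \sum_i c i *: x i.
  apply: contrapT => nu.
  suff : P d.+1 by move/dmax; rewrite ltnn.
  apply/asboolP; exists (fun i => oapp x u (unlift ord0 i)) => c.
  rewrite big_ord_recl unlift_none /=.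
  under eq_bigr do rewrite liftK /=.
  move=> c0; have c00 : c ord0 = 0.
    apply/eqP/negP => cn; apply: nu; exists (fun i => - (c ord0)^-1 * c (lift ord0 i)).
    under eq_bigr do rewrite -scalerA.
    rewrite -scaler_sumr; move: c0 => /eqP; rewrite addr_eq0 => /eqP c0.
    rewrite scaleNr -scalerN -c0 scalerA mulVf ?scale1r //; exact/negP.
  move: c0; rewrite c00 scale0r add0r => /ix c0 i.
  by case: (unliftP ord0 i) => [j|] ->.
have [f fP] := choice gen.
exists d; constructor; pose f' u := \row_i f u i.
have fE u : u = \sum_i f' u 0 i *: x i.
  by rewrite {1}(fP u); apply: eq_bigr => i _; rewrite mxE.
have uniq (v w : 'rV_d) : \sum_i v 0 i *: x i = \sum_i w 0 i *: x i -> v = w.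
  move=> /eqP; rewrite -subr_eq0 -sumrB => /eqP vw; apply/rowP => i.
  apply/eqP; rewrite -subr_eq0; apply/eqP.
  apply: (ix (fun i => v 0 i - w 0 i)); rewrite -[RHS]vw.
  by apply: eq_bigr => j _; rewrite scalerBl.
exists f'.
  move=> a u v; apply: uniq; rewrite -fE {1}(fE u) {1}(fE v) scaler_sumr -big_split /=.
  by apply: eq_bigr => i _; rewrite !mxE scalerDl scalerA.
exists (fun v : 'rV_d => \sum_i v 0 i *: x i) => [u|v]; first by rewrite -fE.
by apply: uniq; rewrite -fE.
Qed.

(** [fdim] is 0 on infinite-dimensional spaces, so independent families bound it from below only
    once the dimension is known to be finite. The a priori bound [s] ensures this. *)
Lemma fdimP s : (forall n (x : 'I_n -> U), independent x -> (n <= s)%N) ->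
  (fdim U <= s)%N /\
  forall n (x : 'I_n -> U), independent x -> (n <= fdim U)%N.
Proof.
move=> bnd; have [d0 dP0] := finite_dim_exists bnd.
have dP : inhabited (Vector.axiom (fdim U) U).
  exact: (@xgetI _ 0%N [set d : nat | inhabited (Vector.axiom d U)]%classic d0 dP0).
split; last by move=> n x; apply: independent_le_dim.
case: dP => -[f lf [g fK gK]].
have lg : linear g.
  by move=> a u v; apply: (can_inj fK); rewrite lf !gK.
pose g' : {linear _ -> U} := HB.pack g (GRing.isLinear.Build _ _ _ *:%R g lg).
apply: (bnd _ (fun i => g (delta_mx 0 i))) => c c0 i.
have : g (\row_i c i) = g 0.
  rewrite -[g]/(g' : _ -> _) linear0 (row_sum_delta (\row_i c i)) linear_sum.
  rewrite -[RHS]c0; apply: eq_bigr => j _.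
  by rewrite linearZ mxE.
by move/(can_inj gK)/rowP/(_ i); rewrite !mxE.
Qed.

End Dimension.

Section Fractions.
Variable k : idomainType.
Local Notation F := {fraction k}.

Lemma fractionP (f : F) : exists a b, b != 0 /\ tofrac b * f = tofrac a.
Proof.
elim/quotW: f => x; exists \n_x, \d_x; split; first exact: denom_ratioP.
have tofracE a : tofrac a = \pi_F (Ratio a 1) by unlock FracField.tofrac.
rewrite !tofracE; transitivity (\pi_F (FracField.mulf (Ratio \d_x 1) x)).
  by symmetry; apply: FracField.pi_mul.
apply/eqmodP => /=.
by rewrite FracField.equivfE /FracField.mulf !numden_Ratio ?mul1r ?oner_neq0 ?denom_ratioP // mulr1 mulrC.
Qed.

Lemma common_denominator n (v : 'I_n -> F) : exists d (w : 'I_n -> k),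
  d != 0 /\ forall i, tofrac (w i) = tofrac d * v i.
Proof.
have /choice[a /choice[b ab]] := fun i => fractionP (v i).
exists (\prod_i b i), (fun i => a i * \prod_(j | j != i) b j); split.
  by apply/prodf_neq0 => i _; have [] := ab i.
move=> i; rewrite [\prod_i b i](bigD1 i) //= !rmorphM /=.
by have [_ <-] := ab i; rewrite mulrAC.
Qed.

End Fractions.

Section Rank.
Variables (k : idomainType).
Local Notation F := {fraction k}.

Lemma spanP (A : lmodType k) (l : seq A) x : x \in span [set` l]%classic ->
  exists c : 'I_(size l) -> k, x = \sum_j c j *: l`_j.
Proof.
case/asboolP => s [sl ->]; elim: s sl => [|[a y] s IH] sl.
  exists (fun=> 0); rewrite big_nil big1 // => i _; exact: scale0r.
have [c IHc] := IH (fun p ps => sl p (@mem_behead _ (_ :: _) _ ps)).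
have yl : y \in l := sl (a, y) (mem_head _ _).
have yn : (index y l < size l)%N by rewrite index_mem.
exists (fun j => c j + (if j == Ordinal yn then a else 0)).
rewrite big_cons IHc /=; under [RHS]eq_bigr do rewrite scalerDl.
rewrite big_split addrC /=; congr (_ + _).
rewrite (bigD1 (Ordinal yn)) //= eqxx nth_index // big1 ?addr0 // => j /negPf->.
exact: scale0r.
Qed.

(** The coefficient matrix has a nonzero kernel vector over the field of fractions; clearing
    denominators brings it into [k]. *)
Lemma span_dependent (A : lmodType k) (l : seq A) n (x : 'I_n -> A) :
  (forall i, x i \in span [set` l]%classic) -> (size l < n)%N ->
  exists2 c : 'I_n -> k, exists i, c i != 0 & \sum_i c i *: x i = 0.
Proof.
move=> xl ln; have /choice[a aP] := fun i => spanP (xl i).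
have [v [i vi] vA] := wide_kernel (\matrix_(i, j) tofrac (a i j)) ln.
have [d [w [d0 wP]]] := common_denominator v.
exists w.
  exists i; rewrite -tofrac_eq0 wP mulf_neq0 ?tofrac_eq0 //.
under eq_bigr do rewrite aP scaler_sumr.
rewrite exchange_big /= big1 // => j _.
under eq_bigr do rewrite scalerA.
rewrite -scaler_suml (_ : \sum_i _ = 0) ?scale0r //.
apply/eqP; rewrite -tofrac_eq0 rmorph_sum /=; apply/eqP.
rewrite -[RHS](mulr0 (tofrac d)) -[in RHS](vA j) mulr_sumr.
by apply: eq_bigr => l' _; rewrite rmorphM /= wP mxE mulrA.
Qed.

Variable N : lmodType k.
Local Notation pure f u := (\pi_(frac_tensor N) (TPure f u)).

Lemma pureDr f (u v : N) : pure f (u + v) = pure f u + pure f v.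
Proof.
by rewrite [RHS]ft_cl_add; apply/frac_tensorP; apply: tcong_pureDr.
Qed.

Lemma pureZ f (c : k) (u : N) : pure f (c *: u) = tofrac c *: pure f u.
Proof.
rewrite [RHS]ft_cl_scale; apply/frac_tensorP.
apply: tcong_trans (tcong_sym (tcong_scale_pure _ _ _)).
by rewrite mulrC; apply/tcong_sym/tcong_pureZ.
Qed.

Lemma pure0 f : pure f (0 : N) = 0.
Proof. by apply: (addrI (pure f 0)); rewrite -pureDr !addr0. Qed.

Lemma frac_tensor_pure (z : frac_tensor N) :
  exists d u, d != 0 /\ tofrac d *: z = pure 1 u.
Proof.
elim/quotW: z; elim=> [f u||x [d [u [d0 IHx]]] y [e [v [e0 IHy]]]
  |x [d [u [d0 IHx]]]|f x [d [u [d0 IHx]]]].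
- have [a [b [b0 abf]]] := fractionP f; exists b, (a *: u); split=> //.
  rewrite [LHS]ft_cl_scale; apply/frac_tensorP.
  apply: tcong_trans (tcong_scale_pure _ _ _) _; rewrite abf -[tofrac a]mul1r.
  exact: tcong_pureZ.
- by exists 1, 0; rewrite oner_eq0 pure0 scaler0.
- exists (e * d), (e *: u + d *: v); split; first exact: mulf_neq0.
  rewrite -ft_cl_add [ft_add _ _]/(_ + _) scalerDr pureDr !pureZ.
  by rewrite -IHx -IHy !scalerA rmorphM /= [tofrac d * _]mulrC.
- exists d, (- u); split=> //.
  rewrite -ft_cl_opp [ft_opp _]/(- _) scalerN IHx.
  by apply: (addrI (pure 1 u)); rewrite -pureDr !subrr pure0.
have [a [b [b0 abf]]] := fractionP f; exists (b * d), (a *: u); split.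
  exact: mulf_neq0.
rewrite -ft_cl_scale [ft_scale _ _]/(f *: (\pi_(frac_tensor N) x : frac_tensor N)) pureZ -IHx !scalerA.
by rewrite rmorphM /= -abf; congr (_ *: _); rewrite mulrAC.
Qed.

(** Up to nonzero scalars every element of the tensor product is a pure tensor with first factor 1,
    so independent elements come from independent elements of [N]. *)
Lemma frac_tensor_dependent s :
  (forall n (x : 'I_n -> N), independent x -> (n <= s)%N) ->
  forall n (z : 'I_n -> frac_tensor N), independent z -> (n <= s)%N.
Proof.
move=> bnd n z iz; have /choice[d /choice[u du]] := fun i => frac_tensor_pure (z i).
apply: (bnd _ u) => c c0 i; have [di dz] := du i.
have : \sum_i (tofrac (c i) * tofrac (d i)) *: z i = 0.
  transitivity (pure 1 (\sum_i c i *: u i)); last by rewrite c0 pure0.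
  rewrite (big_morph (fun u => pure 1 u) (pureDr 1) (pure0 1)).
  by apply: eq_bigr => j _; rewrite pureZ -scalerA; have [_ ->] := du j.
move/iz/(_ i)/eqP; rewrite mulf_eq0 !tofrac_eq0 (negPf di) orbF => /eqP//.
Qed.

Section Functional.
Variable phi : N -> k.
Hypotheses (phiD : forall u v, phi (u + v) = phi u + phi v)
  (phiZ : forall a u, phi (a *: u) = a * phi u).

(** On classes this becomes the [F]-linear form on the tensor product induced by the [k]-linear form
    [phi]. *)
Fixpoint tterm_eval (t : tterm N) : F :=
  match t with
  | TPure f u => f * tofrac (phi u)
  | TZero => 0
  | TAdd x y => tterm_eval x + tterm_eval y
  | TOpp x => - tterm_eval x
  | TScale a x => a * tterm_eval x
  end.

Lemma tterm_eval_cong t t' : tcong t t' -> tterm_eval t = tterm_eval t'.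
Proof.
elim=> //= [x y z _ -> //|x x' y y' _ -> _ -> //|x x' _ -> //|a x x' _ -> //||||||||||||] *.
- by rewrite addrA.
- by rewrite addrC.
- by rewrite add0r.
- by rewrite addNr.
- by rewrite mulrA.
- by rewrite mul1r.
- by rewrite mulrDr.
- by rewrite mulrDl.
- by rewrite mulrDl.
- by rewrite phiD rmorphD mulrDr.
- by rewrite phiZ rmorphM mulrA.
- by rewrite mulrA.
Qed.

Definition tensor_eval (z : frac_tensor N) : F := tterm_eval (repr z).

Lemma tensor_evalE t : tensor_eval (\pi_(frac_tensor N) t) = tterm_eval t.
Proof. by apply: tterm_eval_cong; apply: tcong_repr. Qed.

Lemma tensor_eval_sum n (c : 'I_n -> F) (z : 'I_n -> frac_tensor N) :
  tensor_eval (\sum_i c i *: z i) = \sum_i c i * tensor_eval (z i).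
Proof.
apply: (big_ind2 (fun x y => tensor_eval x = y)).
- exact: (tensor_evalE (TZero _)).
- move=> x _ y _ <- <-; rewrite -[x]reprK -[y]reprK [_ + _]ft_cl_add.
  by rewrite !tensor_evalE.
- move=> i _; rewrite -[z i]reprK [_ *: _]ft_cl_scale.
  by rewrite !tensor_evalE.
Qed.

End Functional.

(** The induced form of [phi i], applied to a linear relation, isolates its [i]-th coefficient. *)
Lemma dual_independent n (x : 'I_n -> N) (phi : 'I_n -> N -> k) :
  (forall i u v, phi i (u + v) = phi i u + phi i v) ->
  (forall i a u, phi i (a *: u) = a * phi i u) ->
  (forall i j, phi i (x j) = (i == j)%:R) ->
  independent (fun i => pure 1 (x i)).
Proof.
move=> phiD phiZ phix c c0 i.
have : tensor_eval (phi i) (\sum_i c i *: pure 1 (x i)) = tensor_eval (phi i) 0.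
  by rewrite c0.
rewrite tensor_eval_sum // (tensor_evalE (phiD i) (phiZ i) (TZero _)) /=.
rewrite (bigD1 i) //= big1 => [|j ji].
  by rewrite tensor_evalE //= phix eqxx rmorph1 !mulr1 addr0.
by rewrite tensor_evalE //= phix eq_sym (negPf ji) rmorph0 !mulr0.
Qed.

Lemma module_rankP s :
  (forall n (x : 'I_n -> N), independent x -> (n <= s)%N) ->
  (module_rank N <= s)%N /\
  forall n (x : 'I_n -> N) (phi : 'I_n -> N -> k),
  (forall i u v, phi i (u + v) = phi i u + phi i v) ->
  (forall i a u, phi i (a *: u) = a * phi i u) ->
  (forall i j, phi i (x j) = (i == j)%:R) ->
  (n <= module_rank N)%N.
Proof.
move=> /frac_tensor_dependent/fdimP[le ge]; split=> // n x phi phiD phiZ phix.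
exact: ge (dual_independent phiD phiZ phix).
Qed.

End Rank.

(** * Growth and generators *)

Section Spans.
Variables (k : nzRingType) (A : lmodType k).
Implicit Types S T : set A.

Lemma mem_span S x : S x -> x \in span S.
Proof.
move=> Sx; apply/asboolP; exists [:: (1, x)]; split=> [p|].
  by rewrite inE => /eqP->.
by rewrite big_seq1 scale1r.
Qed.

Lemma span_min S T x : (forall y, S y -> y \in span T) -> x \in span S ->
  x \in span T.
Proof.
move=> ST /asboolP[s [sS ->]]; rewrite big_seq; apply: rpred_sum => p ps.
by apply: rpredZ; apply: ST; apply: sS.
Qed.

End Spans.

Section Products.
Variables (k : idomainType) (A : pzAlgType k).
Implicit Types (W V : {pred A}) (S T U : set A).

Lemma span_mul S T U x y :
  (forall a b, S a -> T b -> a * b \in span U) ->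
  x \in span S -> y \in span T -> x * y \in span U.
Proof.
move=> STU /asboolP[s [sS ->]] /asboolP[t [tT ->]].
rewrite big_distrl /= big_seq; apply: rpred_sum => p ps.
rewrite big_distrr /= big_seq; apply: rpred_sum => q qt.
rewrite -pz_scalerAl -pz_scalerAr; do 2 apply: rpredZ.
by apply: STU; [apply: sS|apply: tT].
Qed.

Lemma products_mul W m n x y : products W m x -> products W n y ->
  products W (m + n) (x * y).
Proof.
move=> [v vW ->] [w wW ->].
exists (fun i => match split i with inl j => v j | inr j => w j end).
  by move=> i; case: split.
rewrite big_split_ord /=; congr (_ * _); apply: eq_bigr => i _.
  by rewrite (unsplitK (inl _ i)).
by rewrite (unsplitK (inr _ i)).
Qed.

Lemma products0 W : products W 0 1.
Proof. by exists (fun=> 1); [case|rewrite big_ord0]. Qed.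

Lemma products1 W x : x \in W -> products W 1 x.
Proof. by move=> xW; exists (fun=> x) => //; rewrite big_ord_recl big_ord0 mulr1. Qed.

Lemma productsS W n x : products W n.+1 x ->
  exists a b, [/\ a \in W, products W n b & x = a * b].
Proof.
move=> [w wW ->]; rewrite big_ord_recl.
exists (w ord0), (\prod_(i < n) w (lift ord0 i)); split=> //.
by exists (w \o lift ord0) => // i; exact: wW.
Qed.

Lemma span_productsM W m n x y : x \in span (products W m) ->
  y \in span (products W n) -> x * y \in span (products W (m + n)).
Proof.
by apply: span_mul => a b ? ?; apply: mem_span; apply: products_mul.
Qed.

Lemma products_pow1 W n : 1 \in W -> products W n 1.
Proof. by move=> W1; exists (fun=> 1) => //; rewrite big1. Qed.

Lemma span_products_le W m n x : 1 \in W -> (m <= n)%N ->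
  x \in span (products W m) -> x \in span (products W n).
Proof.
move=> W1 mn xm; rewrite -(subnKC mn) -[x]mulr1; apply: span_productsM => //.
by apply: mem_span; apply: products_pow1.
Qed.

Lemma span_products_sub V W c n x :
  (forall y, y \in V -> y \in span (products W c)) ->
  x \in span (products V n) -> x \in span (products W (c * n)).
Proof.
move=> VW; apply: span_min => {x}; elim: n => [|n IH] x.
  case=> w _ ->; rewrite big_ord0 muln0; apply: mem_span; exact: products0.
case/productsS=> a [b [aV bV ->]]; rewrite mulnS; apply: span_productsM.
  exact: VW.
exact: IH.
Qed.

(** Since [1 \in W], the spans of the powers increase, and their union is a subalgebra containing
    [W]. *)
Lemma gen_submod_products W x : gen_submod W -> exists n, x \in span (products W n).
Proof.
case=> _ W1 gen; pose B : {pred A} := fun x => `[< exists n, x \in span (products W n) >].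
suff : x \in B by move/asboolP.
rewrite gen //; last by move=> y yW; apply/asboolP; exists 1%N; apply/mem_span/products1.
  split.
  - by apply/asboolP; exists 0%N; apply/mem_span/products0.
  - move=> y z /asboolP[m ym] /asboolP[n zn]; apply/asboolP; exists (maxn m n).
    by apply: rpredB; [apply: span_products_le ym|apply: span_products_le zn];
      rewrite ?leq_maxl ?leq_maxr.
  - move=> y z /asboolP[m ym] /asboolP[n zn]; apply/asboolP; exists (m + n)%N.
    exact: span_productsM.
move=> a y /asboolP[m ym]; apply/asboolP; exists m; exact: rpredZ.
Qed.

Lemma gen_submod_finite W (s : seq A) : gen_submod W ->
  exists c, forall x, x \in span [set` s]%classic -> x \in span (products W c).
Proof.
move=> gW; have W1 : 1 \in W by case: gW.
suff [c cP] : exists c, forall x, x \in s -> x \in span (products W c).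
  by exists c => x; apply: span_min => y; apply: cP.
elim: s => [|a s [c cP]]; first by exists 0%N.
have [d ad] := gen_submod_products a gW; exists (maxn c d) => x.
rewrite inE => /orP[/eqP->|/cP xc].
  by apply: span_products_le ad => //; apply: leq_maxr.
by apply: span_products_le xc => //; apply: leq_maxl.
Qed.

Lemma growthP W n (l : seq A) :
  (forall x, x \in span (products W n) -> x \in span [set` l]%classic) ->
  (growth W n <= size l)%N /\
  forall m (x : 'I_m -> A) (phi : 'I_m -> A -> k),
    (forall i, x i \in span (products W n)) ->
    (forall i u v, phi i (u + v) = phi i u + phi i v) ->
    (forall i a u, phi i (a *: u) = a * phi i u) ->
    (forall i j, phi i (x j) = (i == j)%:R) ->
  (m <= growth W n)%N.
Proof.
move=> sub; have [] := @module_rankP k (span_type (products W n)) (size l).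
  move=> m x ix; rewrite leqNgt; apply/negP => lm.
  have [c [i ci] c0] := span_dependent (fun i => sub _ (valP (x i))) lm.
  case/eqP: ci; apply: (ix c); apply: val_inj.
  by rewrite linear_sum -[RHS]c0; apply: eq_bigr => j _; rewrite linearZ.
move=> le ge; split=> // m x phi xW phiD phiZ phix.
by apply: (ge m (fun i => Sub (x i) (xW i)) (fun i u => phi i (val u))) => [i u v|i a u|i j];
  rewrite ?SubK.
Qed.

(** Two generating submodules each lie in a power of the other, so passing from [S] to an arbitrary
    [W] rescales [n] by constants only, which the exponent of growth does not see. *)
Lemma has_GKdim_of_generators (R : realType) (S : seq A) (d K : nat) :
  gen_submod (span [set` S]%classic) ->
  (forall m, exists2 l : seq A, (size l <= K * m.+1 ^ d)%N &
    forall x, products (span [set` S]%classic) m x -> x \in span [set` l]%classic) ->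
  (forall j, (0 < d)%N -> (0 < j)%N -> exists n (x : 'I_n -> A) (phi : 'I_n -> A -> k),
    [/\ (j ^ d <= n)%N,
      forall i, x i \in span (products (span [set` S]%classic) (K * j)),
      forall i u v, phi i (u + v) = phi i u + phi i v,
      forall i a u, phi i (a *: u) = a * phi i u &
      forall i j, phi i (x j) = (i == j)%:R]) ->
  has_GKdim A (d%:R%:E : \bar R).
Proof.
set W0 := span _ => gW0 ub lb; split; first by exists W0.
move=> W gW; have [[s sW] W1 _] := gW.
have [c cP] := gen_submod_finite s gW0.
have [e eP] := gen_submod_finite S gW.
have {}ub n : exists2 l : seq A, (size l <= K * (c.+1 * n.+1) ^ d)%N &
    forall x, x \in span (products W n) -> x \in span [set` l]%classic.
  have [l ls lP] := ub (c * n)%N; exists l.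
    apply: leq_trans ls _; rewrite leq_mul2l leq_pexp2r ?orbT //; nia.
  move=> x xW; apply: span_min lP _; apply: span_products_sub xW => y.
  by rewrite sW; apply: cP.
rewrite /GKdim_of.
(* The first summand serves the upper bound, the second the index of the lower bound, and the
   successor makes the constant positive. *)
apply: (@limn_esup_log_growth R (growth W) d (K * c.+1 ^ d + e * K).+1 _ isT) => [n|j d0 j0].
  have [l ls lP] := ub n; have [le _] := growthP lP; apply: leq_trans le _.
  apply: leq_trans ls _; rewrite expnMn mulnA leq_mul2r leqW ?leq_addr ?orbT //.
have [n [x [phi [jn xW phiD phiZ phix]]]] := lb j d0 j0.
have [l _ lP] := ub ((K * c.+1 ^ d + e * K).+1 * j)%N.
have [_ ge] := growthP lP; apply: leq_trans jn (ge n x phi _ phiD phiZ phix) => i.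
apply: (@span_products_le _ (e * (K * j))%N) => //; first by nia.
exact: span_products_sub eP (xW i).
Qed.

End Products.

(** * Spanning monomials *)

Section Presentation.
Variables (k : idomainType) (G : digraph).
Local Notation V := (vertex G).
Local Notation E := (arrow G).
Implicit Types (u v w : V) (e f : E) (p q : seq E).

Definition lpa : pzAlgType k := leavitt k G.
Definition lclass (t : lterm k G) : lpa := \pi_(leavitt k G) t.

Definition lvertex v : lpa := lclass (LVertex k v).
Definition larrow e : lpa := lclass (LArrow k e).
Definition lstar e : lpa := lclass (LStar k e).

Lemma lclassP x y : lcong x y -> lclass x = lclass y.
Proof. by move/leavittP. Qed.

Lemma lclass_repr (a : lpa) : exists t, a = lclass t.
Proof. by exists (repr (a : leavitt k G)); rewrite /lclass reprK. Qed.

Lemma lclass0 : lclass (LZero k G) = 0.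
Proof. by []. Qed.
Lemma lclassD x y : lclass (LAdd x y) = lclass x + lclass y.
Proof. by rewrite /lclass -cl_add. Qed.
Lemma lclassN x : lclass (LOpp x) = - lclass x.
Proof. by rewrite /lclass -cl_opp. Qed.
Lemma lclassZ a x : lclass (LScale a x) = a *: lclass x.
Proof. by rewrite /lclass -cl_scale. Qed.
Lemma lclassM x y : lclass (LMul x y) = lclass x * lclass y.
Proof. by rewrite /lclass -cl_mul. Qed.

Lemma one_lvertex : 1 = \sum_v lvertex v.
Proof. exact: (cl_sum (fun _ : V => true) (fun v => LVertex k v)). Qed.

Lemma lvertexM u v : lvertex u * lvertex v = if u == v then lvertex u else 0.
Proof. by rewrite -lclassM (lclassP (lcong_V _ _ _)); case: ifP. Qed.
Lemma lvertex_larrow u e : lvertex u * larrow e = if u == src e then larrow e else 0.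
Proof.
have /lclassP := lcong_E_src k e; rewrite lclassM -/(lvertex _) -/(larrow _) => h.
by rewrite -{1}h mulrA lvertexM; case: eqP => [->|_]; rewrite ?mul0r.
Qed.
Lemma larrow_lvertex e u : larrow e * lvertex u = if tgt e == u then larrow e else 0.
Proof.
have /lclassP := lcong_E_tgt k e; rewrite lclassM -/(lvertex _) -/(larrow _) => h.
by rewrite -{1}h -mulrA lvertexM; case: eqP => _; rewrite ?mulr0.
Qed.
Lemma lvertex_lstar u e : lvertex u * lstar e = if u == tgt e then lstar e else 0.
Proof.
have /lclassP := lcong_E_star_src k e; rewrite lclassM -/(lvertex _) -/(lstar _) => h.
by rewrite -{1}h mulrA lvertexM; case: eqP => [->|_]; rewrite ?mul0r.
Qed.
Lemma lstar_lvertex e u : lstar e * lvertex u = if src e == u then lstar e else 0.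
Proof.
have /lclassP := lcong_E_star_tgt k e; rewrite lclassM -/(lvertex _) -/(lstar _) => h.
by rewrite -{1}h -mulrA lvertexM; case: eqP => _; rewrite ?mulr0.
Qed.
Lemma lstar_larrow e f : lstar e * larrow f = if e == f then lvertex (tgt e) else 0.
Proof. by rewrite -lclassM (lclassP (lcong_CK1 _ _ _)); case: ifP. Qed.
Lemma lvertex_sum v : ~~ sink v -> lvertex v = \sum_(e | src e == v) larrow e * lstar e.
Proof.
move=> sv; rewrite /lvertex (lclassP (lcong_CK2 k sv)) [LHS]cl_sum.
by apply: eq_bigr => e _; apply: lclassM.
Qed.

Definition generators : seq lpa :=
  [seq lvertex v | v <- enum V] ++ [seq larrow e | e <- enum E] ++ [seq lstar e | e <- enum E].

Lemma generatorsP x : reflect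
  ((exists v, x = lvertex v) \/ (exists e, x = larrow e) \/ (exists e, x = lstar e))
  (x \in generators).
Proof.
rewrite !mem_cat; apply: (iffP or3P).
  by case=> /mapP[y _ ->]; [left|right; left|right; right]; exists y.
by case=> [[v ->]|[[e ->]|[e ->]]];
  [constructor 1|constructor 2|constructor 3]; rewrite map_f ?mem_enum.
Qed.

Local Notation W0 := (span [set` generators]%classic).

Lemma lvertex_gen v : lvertex v \in W0.
Proof. by apply/mem_span/generatorsP; left; exists v. Qed.
Lemma larrow_gen e : larrow e \in W0.
Proof. by apply/mem_span/generatorsP; right; left; exists e. Qed.
Lemma lstar_gen e : lstar e \in W0.
Proof. by apply/mem_span/generatorsP; right; right; exists e. Qed.

Lemma generators_gen_submod : gen_submod W0.
Proof.
split; first by exists generators.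
  by rewrite one_lvertex; apply: rpred_sum => v _; apply: lvertex_gen.
move=> B [B1 BB BM] BZ WB x; apply/idP; rewrite inE /=.
have B0 : 0 \in B by rewrite -(subrr 1) BB.
have BN y : y \in B -> - y \in B by move=> yB; rewrite -sub0r BB.
have [t ->] := lclass_repr x.
elim: t => [v|e|e||s sB t tB|t tB|a t tB|s sB t tB].
- exact/WB/lvertex_gen.
- exact/WB/larrow_gen.
- exact/WB/lstar_gen.
- by rewrite lclass0.
- by rewrite lclassD -[lclass t]opprK; apply: BB => //; apply: BN.
- by rewrite lclassN BN.
- by rewrite lclassZ; apply: BZ.
- by rewrite lclassM; apply: BM.
Qed.

Definition arrows p : lpa := \prod_(e <- p) larrow e.
Definition stars q : lpa := \prod_(e <- rev q) lstar e.

Lemma arrows_nil : arrows [::] = 1. Proof. exact: big_nil. Qed.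
Lemma stars_nil : stars [::] = 1. Proof. exact: big_nil. Qed.
Lemma arrows_cons e p : arrows (e :: p) = larrow e * arrows p.
Proof. exact: big_cons. Qed.
Lemma arrows_rcons p e : arrows (rcons p e) = arrows p * larrow e.
Proof. by rewrite /arrows -cats1 big_cat big_seq1. Qed.
Lemma stars_cons e q : stars (e :: q) = stars q * lstar e.
Proof. by rewrite /stars rev_cons -cats1 big_cat big_seq1. Qed.
Lemma stars_rcons q e : stars (rcons q e) = lstar e * stars q.
Proof. by rewrite /stars rev_rcons big_cons. Qed.

(** This is p q^* for paths ending at [v]; the vertex is kept so that [p] and [q] may be empty. *)
Definition monomial p v q : lpa := arrows p * lvertex v * stars q.

Lemma monomial_cons e p v q : monomial (e :: p) v q = larrow e * monomial p v q.
Proof. by rewrite /monomial arrows_cons !mulrA. Qed.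

Lemma lvertex_monomial x p v q u : is_path x p v ->
  lvertex u * monomial p v q = if u == x then monomial p v q else 0.
Proof.
case: p => [|e p] /=.
  move=> /eqP ->; rewrite /monomial arrows_nil mul1r mulrA lvertexM.
  by case: eqP => [->|_] //; rewrite mul0r.
case/andP=> /eqP <- _; rewrite monomial_cons mulrA lvertex_larrow.
by case: eqP; rewrite ?mul0r.
Qed.

Definition monomials m : set lpa := [set z |
  exists x p v q y, [/\ z = monomial p v q, is_path x p v, is_path y q v,
    (size p <= m)%N & (size q <= m)%N]]%classic.

(** An arrow lengthens [p]. A star cancels the first arrow of [p] by (CK1) or, when [p] is empty,
    lengthens [q]. *)
Lemma mul_generator_monomial m g z : g \in generators -> monomials m z ->
  g * z \in span (monomials m.+1).
Proof.
move=> gS [x [p [v [q [y [-> pP qP pm qm]]]]]].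
have z0 : 0 \in span (monomials m.+1) by exact: rpred0.
case/generatorsP: gS => [[u ->]|[[e ->]|[e ->]]].
- rewrite (lvertex_monomial _ _ pP); case: ifP => // _; apply: mem_span.
  by exists x, p, v, q, y; rewrite !leqW.
- have := larrow_lvertex e (tgt e); rewrite eqxx => <-.
  rewrite -mulrA (lvertex_monomial _ _ pP); case: eqP => [ex|_]; last by rewrite mulr0.
  apply: mem_span; exists (src e), (e :: p), v, q, y.
  by rewrite monomial_cons /= eqxx ex pP ltnS leqW.
- case: p pP pm => [|f p] /=.
    move=> /eqP xv _; rewrite /monomial arrows_nil mul1r mulrA lstar_lvertex -xv.
    case: eqP => [se|_]; last by rewrite mul0r.
    have := lvertex_lstar (tgt e) e; rewrite eqxx => <-; rewrite -mulrA -stars_rcons.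
    apply: mem_span; exists (tgt e), [::], (tgt e), (rcons q e), y.
    rewrite /monomial arrows_nil mul1r /= eqxx is_path_rcons eqxx andbT size_rcons ltnS.
    by split=> //; rewrite se xv.
  case/andP=> sf pP pm; rewrite monomial_cons mulrA lstar_larrow.
  case: eqP => [->|_]; last by rewrite mul0r.
  rewrite (lvertex_monomial _ _ pP) eqxx; apply: mem_span.
  by exists (tgt f), p, v, q, y; rewrite !leqW // ltnW.
Qed.

Lemma products_monomials m x : products W0 m x -> x \in span (monomials m).
Proof.
elim: m x => [|m IH] x.
  case=> w _ ->; rewrite big_ord0 one_lvertex; apply: rpred_sum => v _; apply: mem_span.
  exists v, [::], v, [::], v.
  by rewrite /monomial arrows_nil stars_nil mul1r mulr1 /= eqxx.
case/productsS=> a [b [aW /IH bM ->]].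
apply: span_mul aW bM => g z; exact: mul_generator_monomial.
Qed.

(** * Shortening monomials at cycles without exits *)

Section Reduction.
Hypothesis dis : disjoint_cycles G.

(* The arrow [e] that enters [v] along a cycle without exits is unique and
   satisfies [e e^* = src e], so [p] and [q] need not both end with it. *)
Definition reduced_paths m v : seq (seq E * seq E) :=
  if exitless v then
    [seq (p, q) | p <- entering_paths m v, q <- paths_to m v] ++
    [seq (p, q) | p <- paths_to m v, q <- entering_paths m v]
  else [seq (p, q) | p <- paths_to m v, q <- paths_to m v].

Definition reduced_monomials m : seq lpa :=
  flatten [seq [seq monomial pq.1 v pq.2 | pq <- reduced_paths m v] | v <- enum V].

Lemma mem_reduced_monomials m v p q : (p, q) \in reduced_paths m v ->
  monomial p v q \in reduced_monomials m.
Proof.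
move=> pq; apply/flatten_mapP; exists v; first exact: mem_enum.
by apply/mapP; exists (p, q).
Qed.

(** Common last arrows on a cycle without exits are cancelled one at a time, by induction on [p];
    each cancellation moves the middle vertex back along the cycle. *)
Lemma monomials_reduced m z : monomials m z -> z \in reduced_monomials m.
Proof.
case=> x [p [v [q [y [-> + + + +]]]]] {z}.
elim/last_ind: p v q x y => [|p e IH] v q x y pP qP pm qm.
  apply: mem_reduced_monomials; rewrite /reduced_paths; case: ifP => _.
    rewrite mem_cat; apply/orP; left; apply/allpairs_f; first exact: mem_head.
    exact: mem_paths_to qP qm.
  by apply/allpairs_f; [apply: mem_paths_to pP pm|apply: mem_paths_to qP qm].
case: (boolP (exitless v)) => [xv|nx]; last first.
  apply: mem_reduced_monomials; rewrite /reduced_paths (negPf nx).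
  by apply/allpairs_f; [apply: mem_paths_to pP pm|apply: mem_paths_to qP qm].
case: (boolP (back e)) => be; last first.
  apply: mem_reduced_monomials; rewrite /reduced_paths xv.
  rewrite mem_cat; apply/orP; left; apply/allpairs_f; last exact: mem_paths_to qP qm.
  by apply: mem_entering_paths pP pm _ => p' e' /rcons_inj[_ <-].
have [[q' [f [qE bf]]]|nq] := pselect (exists q' f, q = rcons q' f /\ back f); last first.
  apply: mem_reduced_monomials; rewrite /reduced_paths xv.
  rewrite mem_cat; apply/orP; right; apply/allpairs_f; first exact: mem_paths_to pP pm.
  apply: mem_entering_paths qP qm _ => q' f qf; apply/negP => bf.
  by apply: nq; exists q', f.
move: pP qP pm qm; rewrite qE !is_path_rcons !size_rcons.
move=> /andP[pP /eqP te] /andP[qP /eqP tf] pm qm.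
have ef : e = f by apply: (back_tgt_inj dis); rewrite ?te ?tf.
rewrite -{f bf tf}ef in qP qE *.
suff -> : monomial (rcons p e) v (rcons q' e) = monomial p (src e) q'.
  by apply: IH pP qP _ _; apply: ltnW.
have ns : ~~ sink (src e) by apply/forallPn; exists e; rewrite negbK.
rewrite /monomial arrows_rcons stars_rcons -!mulrA; congr (_ * _).
(* Without exits the sum in (CK2) at [src e] has the single term of [e]. *)
rewrite !mulrA larrow_lvertex te eqxx (lvertex_sum ns) (big_pred1 e) // => f; apply/eqP/eqP => [sf|->//].
by apply/esym/(exitlessP xv); rewrite // -te.
Qed.

(** The exponent at [v] is [2 * level v] off the cycles, 1 more on a cycle without exits and 2 more
    on one with exits. By [vheight_cyclic] the excess is at most [vheight v], and
    [2 * level v + vheight v] is at most the height of the graph. *)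
Lemma size_reduced_monomials : exists K, forall m,
  (size (reduced_monomials m) <= K * m.+1 ^ graph_height G)%N.
Proof.
have [K HK] := path_count dis.
exists (#|V| * (2 * K ^ 2))%N => m.
rewrite size_flatten sumnE /shape -map_comp big_map -mulnA -sum_nat_const big_enum /=.
apply: leq_sum => v _; rewrite size_map.
have [ent pat] := HK m v.
have lH : (2 * level v + vheight v <= graph_height G)%N.
  by have := vheight_graph v; rewrite /level; lia.
have pw a : (a <= graph_height G -> m.+1 ^ a <= m.+1 ^ graph_height G)%N.
  by move=> aH; rewrite leq_pexp2l.
rewrite /reduced_paths; case: ifP => [xv|nx]; [rewrite size_cat !size_allpairs|rewrite size_allpairs].
  have cv : cyclic v by case/andP: xv.
  have := vheight_cyclic dis cv; rewrite xv => h1.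
  have : (size (entering_paths m v) * size (paths_to m v) <= K ^ 2 * m.+1 ^ graph_height G)%N.
    apply: leq_trans (leq_mul ent pat) _; rewrite cv mulnACA -expnD leq_mul2l.
    by rewrite pw ?orbT //; lia.
  by move=> h; rewrite [X in (_ + X)%N]mulnC addnn -mul2n -[leqRHS]mulnA leq_mul2l h orbT.
apply: leq_trans (leq_mul pat pat) _; rewrite mulnACA -expnD.
apply: leq_mul; first by lia.
apply: pw; case: (boolP (cyclic v)) => [cv|_]; last by lia.
by have := vheight_cyclic dis cv; rewrite nx; lia.
Qed.

End Reduction.
End Presentation.

(** * Independent monomials *)

Section Action.
Variables (k : idomainType) (G : digraph).
Local Notation V := (vertex G).
Local Notation E := (arrow G).
Implicit Types (v w : V) (e : E).

Variables (X : Type) (ok : pred X) (start : X -> V) (head : X -> option E)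
  (tail : X -> X) (push : E -> X -> X).
(** [push e] and [tail] are inverse bijections between the states starting at [tgt e] and those with
    head [e], which gives (CK1). States at a vertex that is not a sink have a head, as (CK2)
    demands. *)
Hypothesis head_some : forall x e, ok x -> head x = Some e ->
  [/\ start x = src e, ok (tail x), start (tail x) = tgt e & push e (tail x) = x].
Hypothesis head_push : forall x e, ok x -> start x = tgt e ->
  [/\ ok (push e x), head (push e x) = Some e & tail (push e x) = x].
Hypothesis head_none : forall x, ok x -> head x = None -> sink (start x).

(* [X] encodes a set of paths that cannot be extended, [ok] selecting the valid
   codes.  On functions of such paths, the star of [e] composes with prepending [e],
   and [e] composes with removing [e]. *)
Fixpoint act (t : lterm k G) (f : X -> k) (x : X) : k :=
  match t with
  | LVertex v => if ok x && (start x == v) then f x else 0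
  | LArrow e => if ok x && (head x == Some e) then f (tail x) else 0
  | LStar e => if ok x && (start x == tgt e) then f (push e x) else 0
  | LZero => 0
  | LAdd s t => act s f x + act t f x
  | LOpp t => - act t f x
  | LScale a t => a * act t f x
  | LMul s t => act s (act t f) x
  end.

Lemma act_linear t a f g x :
  act t (fun y => a * f y + g y) x = a * act t f x + act t g x.
Proof.
elim: t f g x => [v|e|e||s IHs t IHt|t IH|b t IH|s IHs t IHt] f g x /=.
- by case: ifP => _ //; rewrite mulr0 addr0.
- by case: ifP => _ //; rewrite mulr0 addr0.
- by case: ifP => _ //; rewrite mulr0 addr0.
- by rewrite mulr0 addr0.
- by rewrite IHs IHt mulrDr addrACA.
- by rewrite IH opprD mulrN.
- by rewrite IH mulrDr mulrCA.
- rewrite -IHs; congr act; apply: funext => y; exact: IHt.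
Qed.

Lemma actD t f g x : act t (fun y => f y + g y) x = act t f x + act t g x.
Proof.
rewrite -[act t f x]mul1r -act_linear; congr act.
by apply: funext => y; rewrite mul1r.
Qed.

Lemma act0 t x : act t (fun=> 0) x = 0.
Proof. by apply: (addrI (act t (fun=> 0) x)); rewrite -actD !addr0. Qed.

Lemma actZ t a f x : act t (fun y => a * f y) x = a * act t f x.
Proof.
rewrite -[RHS]addr0 -(act0 t x) -act_linear; congr act.
by apply: funext => y; rewrite addr0.
Qed.

Lemma act_cong s t : lcong s t -> forall f x, act s f x = act t f x.
Proof.
elim=> {s t} /=.
- by [].
- by move=> s t _ IH f x; rewrite IH.
- by move=> s t r _ IH1 _ IH2 f x; rewrite IH1.
- by move=> s s' t t' _ IHs _ IHt f x; rewrite IHs IHt.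
- by move=> s s' _ IH f x; rewrite IH.
- by move=> a s s' _ IH f x; rewrite IH.
- move=> s s' t t' _ IHs _ IHt f x; rewrite IHs; congr act.
  by apply: funext => y; apply: IHt.
- by move=> *; rewrite addrA.
- by move=> *; rewrite addrC.
- by move=> *; rewrite add0r.
- by move=> *; rewrite addNr.
- by move=> *; rewrite mulrA.
- by move=> *; rewrite mul1r.
- by move=> *; rewrite mulrDr.
- by move=> *; rewrite mulrDl.
- by [].
- by [].
- by move=> s t r f x; rewrite actD.
- by [].
- by move=> a s t f x; rewrite actZ.
- move=> v w f x; case: (eqVneq v w) => [->|vw] /=; first by case: (_ && _).
  by case: ifP => // /andP[-> /eqP->]; rewrite /= (negPf vw).
- move=> e f x; case: (boolP (ok x)) => //= xok.
  case: (eqVneq (head x) (Some e)) => [he|_]; last by rewrite if_same.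
  by have [-> _ _ _] := head_some xok he; rewrite eqxx.
- move=> e f x; case: (boolP (ok x)) => //= xok.
  case: (eqVneq (head x) (Some e)) => [he|_] //.
  by have [_ -> -> _] := head_some xok he; rewrite eqxx.
- by move=> e f x; case: ifP => // ->.
- move=> e f x; case: (boolP (ok x)) => //= xok.
  case: eqP => // sx; have [pok hp _] := head_push xok sx.
  by have [-> _ _ _] := head_some pok hp; rewrite pok eqxx.
- move=> e f g x; case: (eqVneq e f) => [->|ef] /=.
    case: (boolP (ok x)) => //= xok; case: eqP => // sx.
    by have [-> -> ->] := head_push xok sx; rewrite eqxx.
  case: (boolP (ok x)) => //= xok; case: eqP => // sx.
  have [-> -> _] := head_push xok sx; rewrite /=.
  by rewrite (inj_eq Some_inj) (negPf ef).
(* For (CK2), a state at [v] has exactly one head, and only the summand of that arrow survives. *)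
move=> v sv f x.
rewrite (big_morph (fun t => act t f x) (op1 := +%R) (id1 := 0)) //=.
case: (boolP (ok x)) => [xok|_] /=; last by rewrite big1.
case hx : (head x) => [e|].
  have [-> tok ts tp] := head_some xok hx.
  case: eqP => [<-|nv].
    rewrite (bigD1 e) //= eqxx tok ts eqxx tp /= big1 ?addr0 // => e' /andP[_ ne].
    by rewrite (inj_eq Some_inj) eq_sym (negPf ne).
  rewrite big1 // => e' /eqP e'v; rewrite (inj_eq Some_inj); case: eqP => // ee.
  by case: nv; rewrite ee.
rewrite big1 //; case: eqP => // xv.
by move: sv; rewrite -xv head_none.
Qed.

Definition rep (a : lpa k G) : (X -> k) -> X -> k := act (repr (a : leavitt k G)).

Lemma rep_lclass t f x : rep (lclass t) f x = act t f x.
Proof. by apply: act_cong; apply: lcong_repr. Qed.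

Lemma repD a b f x : rep (a + b) f x = rep a f x + rep b f x.
Proof.
have [s ->] := lclass_repr a; have [t ->] := lclass_repr b.
by rewrite -lclassD !rep_lclass.
Qed.

Lemma repZ c a f x : rep (c *: a) f x = c * rep a f x.
Proof. by have [s ->] := lclass_repr a; rewrite -lclassZ !rep_lclass. Qed.

Lemma repM a b f x : rep (a * b) f x = rep a (rep b f) x.
Proof.
have [s ->] := lclass_repr a; have [t ->] := lclass_repr b.
rewrite -lclassM !rep_lclass /=; congr act.
by apply: funext => y; rewrite rep_lclass.
Qed.

End Action.

(** * The representation at a sink or a cycle without exits *)

Section LowerBound.
Variables (k : idomainType) (G : digraph).
Local Notation V := (vertex G).
Local Notation E := (arrow G).
Local Notation leadsto := (connect (@adj G)).
Implicit Types (u v : V) (e f : E) (p q : seq E).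

Variables (w : V) (c0 : option E) (c' : seq E).

Definition first_path x p := is_path x p w && all (fun e => src e != w) p.

(** Beyond [w] every vertex emits at most one arrow, so a path is determined by its start and by
    stopping at [w]. *)
Lemma exitless_first_path x p q : exitless w -> leadsto w x ->
  first_path x p -> first_path x q -> p = q.
Proof.
move=> xw; elim: p q x => [|e p IH] [|f q] x wx //=.
- by move=> /andP[/= /eqP-> _] /andP[/= /andP[-> _]].
- by move=> /andP[/= /andP[/eqP<- _] /andP[sw _]] /andP[/= /eqP xw' _]; rewrite xw' eqxx in sw.
case/andP=> /= /andP[/eqP se pP] /andP[_ pw] /andP[/= /andP[/eqP sf qP] /andP[_ qw]].
have ef : e = f by apply: (exitlessP xw); rewrite ?se ?sf.
rewrite -ef in qP *; congr (_ :: _); apply: (IH q (tgt e)).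
- by apply: connect_trans wx _; rewrite -se; apply: leadsto_arrow.
- by apply/andP.
- by apply/andP.
Qed.

Hypothesis terminal : if c0 is Some e then
    [/\ exitless w, src e = w & first_path (tgt e) c'] else sink w.

(* A state is a path that ends at its first visit to [w], followed, if [w] lies
   on the cycle [e c'], by infinitely many turns around that cycle.  The integer
   counts turns, so that going around the cycle has infinite order. *)
Local Notation X := (seq E * int)%type.

Definition state_start (x : X) : V := if x.1 is e :: _ then src e else w.
Definition state_ok (x : X) : bool := first_path (state_start x) x.1.
Definition state_head (x : X) : option E := if x.1 is e :: _ then Some e else c0.
(** At [w] a new turn is unrolled: its first arrow is removed, [c'] remains in front, and one turn
    is deducted. *)
Definition state_tail (x : X) : X :=
  if x.1 is e :: p then (p, x.2) else (c', x.2 - 1).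
Definition state_push (e : E) (x : X) : X :=
  if src e == w then ([::], x.2 + 1) else (e :: x.1, x.2).

Lemma first_path_start x p z : first_path x p -> state_start (p, z) = x.
Proof.
by case: p => [|e p]; rewrite /first_path /= => /andP[]; [move=> /eqP|move=> /andP[/eqP]].
Qed.

Lemma first_path_ok x p z : first_path x p -> state_ok (p, z).
Proof. by move=> xp; rewrite /state_ok (first_path_start z xp). Qed.

Lemma state_head_some x e : state_ok x -> state_head x = Some e ->
  [/\ state_start x = src e, state_ok (state_tail x), state_start (state_tail x) = tgt e
    & state_push e (state_tail x) = x].
Proof.
case: x => [[|f p] z] /=; rewrite /state_ok /state_head /state_tail /state_push /=.
  move=> _ ce; move: terminal; rewrite ce => -[xw sw fp].
  rewrite (first_path_start _ fp) sw eqxx fp subrK; split=> //.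
case/andP=> /= /andP[_ pP] /andP[fw pw] [<-].
have fp : first_path (tgt f) p by apply/andP.
by rewrite (first_path_start _ fp) (negPf fw).
Qed.

(** The delicate case is [src e = w], where pushing discards the finite part and counts a turn. No
    information is lost, since that part must be [c'] by [exitless_first_path]. *)
Lemma state_head_push x e : state_ok x -> state_start x = tgt e ->
  [/\ state_ok (state_push e x), state_head (state_push e x) = Some e & state_tail (state_push e x) = x].
Proof.
case: x => p z xok sx; move: (xok); rewrite /state_ok sx => /= fp.
rewrite /state_push /=; case: eqP => sw; last first.
  by split=> //; rewrite /state_ok /first_path /= eqxx; move/eqP: sw => -> /=.
rewrite /state_head /state_tail /= /state_ok /first_path /= eqxx.
move: terminal; case ce : c0 => [f|]; last by move/forallP/(_ e); rewrite sw eqxx.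
case=> xw sf fc; have ef : e = f by apply: (exitlessP xw); rewrite ?sw ?sf.
rewrite ef addrK; split=> //; congr (_, _); rewrite -ef in fc.
apply: exitless_first_path xw _ fc fp; rewrite -[w in connect _ w]sw; exact: leadsto_arrow.
Qed.

Lemma state_head_none x : state_ok x -> state_head x = None -> sink (state_start x).
Proof.
case: x => [[|f p] z] //= _; rewrite /state_head /state_start /= => ce.
by move: terminal; rewrite ce.
Qed.

Local Notation rho := (@rep k G X state_ok state_start state_head state_tail state_push).
Let rho_lclass := @rep_lclass k G X state_ok state_start state_head state_tail state_push
  state_head_some state_head_push state_head_none.
Let rhoM := @repM k G X state_ok state_start state_head state_tail state_push
  state_head_some state_head_push state_head_none.

(** The action of [p] strips [p] from the state. Paths that meet [w] only at their end are never
    proper prefixes of one another, so the result is zero unless [p = p']. *)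
Lemma rho_arrows x p p' z y g : first_path x p -> state_ok (p', z) -> lvertex k w * y = y ->
  rho (arrows k p * y) g (p', z) = if p == p' then rho y g ([::], z) else 0.
Proof.
move=> + + wy; elim: p x p' => [|e p IH] x [|f p'].
- by rewrite arrows_nil mul1r.
- rewrite arrows_nil mul1r -wy => _ /andP[_ /= /andP[fw _]].
  by rewrite rhoM rho_lclass /= /state_start /= (negPf fw) andbF.
- case/andP=> _ /andP[ew _] _; rewrite arrows_cons -mulrA rhoM rho_lclass /=.
  rewrite /state_head /=; case: eqP => [ce|_]; last by rewrite andbF.
  by move: terminal ew; rewrite ce => -[_ -> _]; rewrite eqxx.
case/andP=> /= /andP[_ pP] /andP[_ pw] fok; rewrite arrows_cons -mulrA rhoM rho_lclass /=.
rewrite fok /state_head /= (inj_eq Some_inj) eqseq_cons eq_sym; case: eqP => //= ef.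
rewrite /state_tail /=; apply: (IH (tgt e)); first exact/andP.
case/andP: fok => /= /andP[_ p'P] /andP[_ p'w].
by apply: (@first_path_ok (tgt f)); apply/andP.
Qed.

Lemma rho_stars x q z g : first_path x q ->
  rho (lvertex k w * stars k q) g ([::], z) = g (q, z).
Proof.
elim: q x g => [|e q IH] x g.
  by rewrite stars_nil mulr1 rho_lclass /= /state_ok /first_path /= /state_start /= eqxx.
case/andP=> /= /andP[_ qP] /andP[ew qw].
have fq : first_path (tgt e) q by apply/andP.
rewrite stars_cons mulrA rhoM (IH (tgt e)) // rho_lclass /=.
by rewrite (first_path_ok _ fq) (first_path_start _ fq) eqxx /state_push (negPf ew).
Qed.

Definition turn : lpa k G := if c0 is Some e then arrows k (e :: c') else 1.

Lemma lvertex_turn y a : lvertex k w * y = y -> lvertex k w * (turn ^+ a * y) = turn ^+ a * y.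
Proof.
move=> wy; case: a => [|a]; first by rewrite expr0 mul1r.
rewrite exprS /turn; move: terminal; case: c0 => [e|] => [[_ sw _]|_].
  by rewrite arrows_cons !mulrA lvertex_larrow sw eqxx.
by rewrite expr1n !mul1r.
Qed.

Lemma rho_turn y a z g : lvertex k w * y = y -> c0 != None \/ a = 0%N ->
  rho (turn ^+ a * y) g ([::], z) = rho y g ([::], z - a%:Z).
Proof.
move=> wy; elim: a z => [|a IH] z ca; first by rewrite expr0 mul1r subr0.
case: ca => // cs; move: IH => /(_ _ (or_introl cs)) IH.
rewrite exprS -mulrA {1}/turn; have wy' := lvertex_turn a wy.
case ce : c0 cs => [e|] // _; move: terminal; rewrite ce => -[_ sw fc].
have wok : state_ok ([::], z) by rewrite /state_ok /first_path /= eqxx.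
have wh : state_head ([::], z) = Some e by rewrite /state_head.
rewrite arrows_cons -mulrA rhoM rho_lclass /= wok wh eqxx [state_tail _]/=.
rewrite (rho_arrows _ fc (first_path_ok _ fc) wy') eqxx IH.
by congr (rho _ _ (_, _)); rewrite -addrA -opprD -intS.
Qed.

(* The monomial p C^a q^*, where C is the cycle [c0 c'] through [w]. *)
Definition turn_monomial (t : seq E * seq E * nat) : lpa k G :=
  arrows k t.1.1 * (turn ^+ t.2 * (lvertex k w * stars k t.1.2)).

(** The matrix coefficient between the states (p, a) and (q, 0): p C^a q^* strips [p] and [a] turns
    from the former and prepends [q], arriving at the latter. *)
Definition turn_coef (t : seq E * seq E * nat) (a : lpa k G) : k :=
  rho a (fun y => (y == (t.1.2, 0%Z))%:R) (t.1.1, t.2%:Z).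

Lemma turn_coef_monomial u v t t' :
  first_path u t.1.1 -> first_path u t'.1.1 -> first_path v t'.1.2 ->
  c0 != None \/ t'.2 = 0%N ->
  turn_coef t (turn_monomial t') = (t == t')%:R.
Proof.
case: t t' => [[p q] a] [[p' q'] a'] /= pP p'P q'P ca.
have ww : lvertex k w * (lvertex k w * stars k q') = lvertex k w * stars k q'.
  by rewrite mulrA lvertexM eqxx.
rewrite /turn_coef /turn_monomial /=.
rewrite (rho_arrows _ p'P (first_path_ok _ pP) (lvertex_turn _ ww)).
rewrite rho_turn // (rho_stars _ _ q'P) !xpair_eqE eq_sym.
case: (p == p') => //=; rewrite [q' == q]eq_sym; case: (q == q') => //=.
by rewrite subr_eq0.
Qed.

Lemma turn_monomial_products m n t : (size t.1.1 <= m)%N -> (size t.1.2 <= m)%N ->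
  (t.2 <= n)%N ->
  turn_monomial t \in span (products (span [set` generators k G]%classic)
    (m + ((size c').+1 * n + (1 + m)))).
Proof.
set W0 := span [set` generators k G]%classic; have [_ W1 _] := generators_gen_submod k G.
have mul1 (s : seq E) (F : E -> lpa k G) l : (forall e, F e \in W0) -> (size s <= l)%N ->
    \prod_(e <- s) F e \in span (products W0 l).
  move=> FW sl; apply: (span_products_le W1 sl).
  elim: s {sl} => [|e s IH]; first by rewrite big_nil; apply/mem_span/products0.
  rewrite big_cons; apply: (@span_productsM _ _ W0 1 (size s)) IH.
  exact/mem_span/products1.
move=> pm qm an; apply: span_productsM; first by apply: mul1 => // e; apply: larrow_gen.
apply: span_productsM; last first.
  apply: span_productsM; first by apply/mem_span/products1; apply: lvertex_gen.
  by apply: mul1; rewrite ?size_rev // => e; apply: lstar_gen.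
apply: (@span_products_le _ _ W0 ((size c').+1 * t.2)) => //; first by rewrite leq_mul2l an orbT.
elim: (t.2) => [|a IH]; first by rewrite muln0 expr0; apply/mem_span/products0.
rewrite exprS mulnS; apply: span_productsM IH.
rewrite /turn; case: c0 => [e|]; first by apply: mul1 => // f; apply: larrow_gen.
exact/mem_span/products_pow1.
Qed.

End LowerBound.

(** * Counting the separated monomials and conclusion *)

Lemma exitless_cycle G (w : vertex G) : exitless w -> exists e c',
  src e = w /\ first_path w (tgt e) c'.
Proof.
case/andP=> /existsP[e /andP[/eqP sw be]] _.
have ew : connect (@adj G) (tgt e) w by rewrite -sw.
have [l /(_ 0%N)] := first_paths_leadsto ew (or_introl erefl).
rewrite first_paths_end addn0.
case h : (first_paths _ _ _) => [|c' s] // _; exists e, c'; split=> //.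
have : c' \in first_paths w l (tgt e) by rewrite h mem_head.
by case/mem_first_paths => cP cw _; apply/andP.
Qed.

(** The binomial coefficient is at least the [d]-th power of [d! * j] divided by [d!]; scaling [j]
    by [d!] absorbs this denominator. *)
Lemma leq_exp_bin d j : (j ^ d <= 'C(d + d`! * j, d))%N.
Proof.
rewrite -(leq_pmul2r (fact_gt0 d)) bin_ffact.
have ffl n m : (n ^ m <= (n + m) ^_ m)%N.
  elim: m n => [|m IH] n //; rewrite addnS ffactSS expnS leq_mul //.
  by rewrite -addnS leq_addr.
rewrite addnC; apply: leq_trans (ffl _ _); rewrite expnMn mulnC leq_mul2r.
apply/orP; right; case: d {ffl} => // d; rewrite -{1}[_`!]expn1 leq_pexp2l ?fact_gt0 //.
Qed.

(** With [p] and [q] each ranging over at least [j ^ d] paths, and [j] exponents of the terminal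
    cycle if there is one, at least [j ^ (2 * d + b)] monomials are separated. *)
Lemma lower_growth (k : idomainType) G : disjoint_cycles G ->
  exists K, forall j, (0 < graph_height G)%N -> (0 < j)%N ->
  exists n (x : 'I_n -> lpa k G) (phi : 'I_n -> lpa k G -> k),
    [/\ (j ^ graph_height G <= n)%N,
      forall i, x i \in span (products (span [set` generators k G]%classic) (K * j)),
      forall i u v, phi i (u + v) = phi i u + phi i v,
      forall i a u, phi i (a *: u) = a * phi i u &
      forall i j, phi i (x j) = (i == j)%:R].
Proof.
move=> dis; have [h0|h0] := posnP (graph_height G).
  by exists 0%N => j; rewrite h0.
have [c hc] : exists c : cyc G, graph_height G = height (inr c : node G).
  have [|c gc] := @bigop.eq_bigmax _ (fun c : cyc G => height (inr c : node G)).
    rewrite lt0n; apply: contraTneq h0 => none.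
    by rewrite -leqNgt /graph_height big_pred0 // => c; have := card0_eq none c.
  by exists c.
have [u [w [d [K0 [b [_ hH wb HK0]]]]]] := height_first_paths dis (inr c).
have [c0 [c' [term cb]]] : exists c0 c', (if c0 is Some e then
    [/\ exitless w, src e = w & first_path w (tgt e) c'] else sink w) /\ b = isSome c0.
  case: b wb {hH} => wb; last by exists None, [::].
  by have [e [c' [sw fc]]] := exitless_cycle wb; exists (Some e), c'.
pose L := (size c').+1; pose M := (K0 * (d + d`!))%N.
(* For [j > 0], [M * j] bounds the lengths of [p] and [q], [L * j] that of the turns, and the 1
   stands for the vertex. *)
exists (M + (L + (1 + M)))%N => j _ j0.
pose m := (K0 * (d + d`! * j))%N.
have mM : (m <= M * j)%N by rewrite /m /M; nia.
pose P := first_paths w m u.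
pose T := [seq (pq, a) | pq <- [seq (p, q) | p <- P, q <- P], a <- iota 0 (if b then j else 1%N)].
have UT : uniq T.
  apply: allpairs_uniq; last by case=> ? ? [? ?] _ _ [-> ->].
    by apply: allpairs_uniq; rewrite ?first_paths_uniq // => -[? ?] [? ?] _ _ [-> ->].
  exact: iota_uniq.
have Tfirst t : t \in T -> [/\ t.1.1 \in P, t.1.2 \in P & t.2 \in iota 0 (if b then j else 1%N)].
  by case/allpairsP => -[[p q] a] /= [/allpairsP[[p1 q1] /= [p1P q1P [-> ->]]] aj ->].
have PP p : p \in P -> first_path w u p /\ (size p <= m)%N.
  by case/mem_first_paths => h1 h2 h3; rewrite /first_path h1 h2.
pose t0 : seq (arrow G) * seq (arrow G) * nat := ([::], [::], 0%N).
have mT (i : 'I_(size T)) : nth t0 T i \in T by rewrite mem_nth.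
exists (size T), (fun i => turn_monomial k w c0 c' (nth t0 T i)),
  (fun i => turn_coef w c0 c' (nth t0 T i)); split.
- rewrite !size_allpairs size_iota hc hH expnD mulnC mul2n -addnn expnD.
  have h : (j ^ d <= size P)%N.
    by apply: leq_trans (leq_exp_bin d j) _; apply: HK0.
  rewrite mulnC; apply: leq_mul; first exact: leq_mul.
  by case: (b).
- move=> i; have [/PP[_ h1] /PP[_ h2]] := Tfirst _ (mT i).
  rewrite mem_iota add0n => /andP[_ h3].
  have h4 : ((nth t0 T i).2 <= j)%N by apply: ltnW; apply: leq_trans h3 _; case: (b).
  have [_ W1 _] := generators_gen_submod k G.
  apply: span_products_le W1 _ (turn_monomial_products k w c0 c' h1 h2 h4).
  by rewrite -/L !mulnDl mul1n; do ![apply: leq_add => //].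
- by move=> i x y; exact: (repD (state_head_some term) (state_head_push term) (state_head_none term)).
- by move=> i a x; exact: (repZ (state_head_some term) (state_head_push term) (state_head_none term)).
move=> i i'; have [/PP[h1 _] /PP[h2 _] _] := Tfirst _ (mT i).
have [/PP[h3 _] /PP[h4 _]] := Tfirst _ (mT i').
rewrite mem_iota add0n => /andP[_ h5].
rewrite (turn_coef_monomial k term h1 h3 h4); first by rewrite nth_uniq.
case: (c0) cb h5 => [e|] ->; [by left|right].
by case: (_.2) h5.
Qed.

Theorem theorem28 (R : realType) (k : idomainType) (G : digraph)
  (hG : disjoint_cycles G) :
  has_GKdim (leavitt k G) ((graph_height G)%:R%:E : \bar R)%R.
Proof.
have [K1 H1] := size_reduced_monomials k hG.
have [K2 H2] := lower_growth k hG.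
have gS := generators_gen_submod k G.
apply: (@has_GKdim_of_generators k (lpa k G) R (generators k G) _ (K1 + K2)) => //.
  move=> m; exists (reduced_monomials k G m).
    by apply: leq_trans (H1 m) _; rewrite leq_mul2r leq_addr orbT.
  move=> x /products_monomials; apply: span_min => y /(monomials_reduced hG) yl.
  exact: mem_span.
move=> j d0 j0; have [n [x [phi [h1 h2 h3 h4 h5]]]] := H2 j d0 j0.
exists n, x, phi; split=> // i; apply: span_products_le (h2 i); last first.
  by rewrite leq_mul2r leq_addl orbT.
by case: gS.
Qed.
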